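(* Let $$k(T) = 63(3T^2 - 3T + 1)(T^2 + T + 1)(T^2 - 3T + 3) \in \mathbb{Q}[T].$$ Then the elliptic curve $E_{k(T)}$ over the rational function field $\mathbb{Q}(T)$ given by $$E_{k(T)}:\ X^3 + Y^3 = k(T)$$ has Mordell–Weil rank exactly $2$ over $\mathbb{Q}(T)$.
   Context: The projective closure of the plane cubic $X^3+Y^3=k(T)$ over $\mathbb{Q}(T)$ is an elliptic curve (a cubic twist of $X^3+Y^3=1$, with $j$-invariant $0$). The rank is that of the finitely generated abelian group $E_{k(T)}(\mathbb{Q}(T))$. *)

(* Defs.v *)
From HB Require Import structures.
From mathcomp Require Import all_boot all_order all_algebra.
From mathcomp Require Import fraction.
Set Implicit Arguments.
Unset Strict Implicit.
Unset Printing Implicit Defensive.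
Import Order.TTheory GRing.Theory Num.Theory.
Local Open Scope ring_scope.

(* The plane cubic  C_k : X^3 + Y^3 = k Z^3  over a field K (k <> 0).
   A K-rational point is represented as [None] for the point at infinity
   O = [1 : -1 : 0] (over a field where t^2 - t + 1 has no root, e.g. Q(T),
   it is the only K-rational point at infinity), or [Some (x, y)] for the
   affine point (x, y) with x^3 + y^3 = k. *)
Definition cpoint (K : fieldType) := option (K * K)%type.

Definition on_cubic (K : fieldType) (k : K) (P : cpoint K) : bool :=
  match P with
  | None => true
  | Some (x, y) => x ^+ 3 + y ^+ 3 == k
  end.

(* Group law (chord-and-tangent) with neutral element O = [1:-1:0], which is
   a flex of the cubic; -(x,y) = (y,x).  P + Q := -(P * Q), where P * Q is the
   third intersection point of the line PQ with the cubic. *)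
Definition cneg (K : fieldType) (P : cpoint K) : cpoint K :=
  match P with
  | None => None
  | Some (x, y) => Some (y, x)
  end.

(* -(third point) on the non-vertical line of slope m through (x1,y1) meeting
   the cubic also at x = x2 (with multiplicity). *)
Definition cchord (K : fieldType) (m x1 y1 x2 : K) : cpoint K :=
  if m == -1 then None (* line parallel to x + y = 0: passes through O *)
  else
    let b := y1 - m * x1 in
    let x3 := - (3%:R * m ^+ 2 * b) / (1 + m ^+ 3) - x1 - x2 in
    Some (m * x3 + b, x3).

Definition cadd (K : fieldType) (P Q : cpoint K) : cpoint K :=
  match P, Q with
  | None, _ => Q
  | _, None => P
  | Some (x1, y1), Some (x2, y2) =>
      if (x1 == x2) && (y1 == y2) then
        if y1 == 0 then Some (0, x1) (* vertical tangent *)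
        else cchord (- (x1 ^+ 2 / y1 ^+ 2)) x1 y1 x1
      else if x1 == x2 then
        (* vertical chord x = x1: third point (x1, -y1-y2) *)
        Some (- (y1 + y2), x1)
      else cchord ((y2 - y1) / (x2 - x1)) x1 y1 x2
  end.

Definition cmul (K : fieldType) (n : int) (P : cpoint K) : cpoint K :=
  match n with
  | Posz m => iter m (cadd P) None
  | Negz m => cneg (iter m.+1 (cadd P) None)
  end.

Definition clincomb (K : fieldType) (ns : seq int) (Ps : seq (cpoint K))
  : cpoint K :=
  foldr (fun np acc => cadd (cmul np.1 np.2) acc) None (zip ns Ps).

Definition cindependent (K : fieldType) (Ps : seq (cpoint K)) : Prop :=
  forall ns : seq int, size ns = size Ps ->
    clincomb ns Ps = None -> all (fun n => n == 0) ns.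

Definition MW_rank_eq (K : fieldType) (k : K) (r : nat) : Prop :=
  (exists Ps : seq (cpoint K),
      [/\ size Ps = r, all (on_cubic k) Ps & cindependent Ps]) /\
  (forall Ps : seq (cpoint K),
      size Ps = r.+1 -> all (on_cubic k) Ps -> ~ cindependent Ps).

Definition QT := {fraction {poly rat}}.

Definition kpoly : {poly rat} :=
  63%:R * (3%:R * 'X ^+ 2 - 3%:R * 'X + 1) * ('X ^+ 2 + 'X + 1)
        * ('X ^+ 2 - 3%:R * 'X + 3%:R).

Definition kT : QT := tofrac kpoly.

(* Main.v *)
(* Let w be a primitive cube root of unity.  Over Q(w)(T) the curve has complex
   multiplication by Z[w], and sqrt(-3) acts as w - w^2.  Over Q(w) the
   polynomial k splits into six linear factors; at each root t of k the value
   of - X / Y at t is a cube root of unity, and these six "slots" form a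
   homomorphism to (Z/3)^6 whose kernel is the image of sqrt(-3).  A descent
   argument, with the 7-adic valuation of the norm as the only obstruction to
   being a cube in Q(w), shows that the slots of all points lie in the
   27-element group spanned by those of two explicit points Q1, Q2 defined
   over Q(T) and of a torsion point T.  So every point is congruent to a
   combination of Q1, Q2 and T modulo sqrt(-3).

   The height max(deg X, deg Y) is multiplied exactly by 3 under sqrt(-3), and
   it vanishes only on torsion.  Counting points of bounded height then shows
   that six points are always dependent over Z.  For three points P_i over
   Q(T), apply this to the P_i and w P_i: a relation A + w B = 0 with A and B
   defined over Q(T) forces A = B = 0, so the P_i are dependent.  Conversely
   the slots show that a relation between Q1 and Q2 is divisible by 3, hence
   trivial by infinite descent. *)

Require Import Defs.
From HB Require Import structures.
From mathcomp Require Import all_boot all_order all_algebra.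
From mathcomp Require Import fraction separable.
From mathcomp Require Import ring lra zify.
Set Implicit Arguments.
Unset Strict Implicit.
Unset Printing Implicit Defensive.
Import Order.TTheory GRing.Theory Num.Theory.
Local Open Scope ring_scope.

(** * The group of points *)

(** The chord-and-tangent law of the statement is a case analysis. As k is not a cube, Y vanishes at
    no rational point, so the chart Y = 1 is global and one formula without exceptional pairs
    defines the group. Its axioms become ideal memberships with explicit cofactors, and the law of
    the statement is matched to it once, in [cpoint_rel_add].

    The height is not canonical: instead of a parallelogram law, only h(P + Q) <= 2 h(P) + 2 h(Q) is
    proved. Since h(3P) = 9 h(P), a combination whose coefficients have m ternary digits has height
    O(18^m). On the other side, n steps of division by sqrt(-3) give 9^n codes, and these separate
    points modulo torsion as long as their differences have height below 3^n. For N points a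
    collision requires 3^(N m) > 9^n with 3^n above a multiple of 18^m. Six points, which three
    points and their images under w provide, allow 3^n close to 27^m, and this leaves room for the
    crude inequality; five would only allow about 15.6^m. *)

Section RotatedLaw.
Variables (K : fieldType) (k : K).

(* The rotated addition law of Bernstein, Chuengsatiansup, Kohel and Lange
   (Twisted Hessian curves) for X^3 + Y^3 = k Z^3 with neutral element
   [1 : -1 : 0]; it has no exceptional pairs when k is not a cube. *)
Definition rotX (x1 y1 z1 x2 y2 z2 : K) :=
  x2 ^+ 2 * x1 * y1 + k * z1 ^+ 2 * z2 * y2.
Definition rotY (x1 y1 z1 x2 y2 z2 : K) :=
  - k * z2 ^+ 2 * z1 * x1 - y1 ^+ 2 * x2 * y2.
Definition rotZ (x1 y1 z1 x2 y2 z2 : K) :=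
  y2 ^+ 2 * z1 * y1 - x1 ^+ 2 * z2 * x2.

Definition on_chart (x z : K) := x ^+ 3 + 1 == k * z ^+ 3.

Lemma on_chartE x z : on_chart x z -> x ^+ 3 + 1 - k * z ^+ 3 = 0.
Proof. by rewrite /on_chart -subr_eq0 => /eqP. Qed.

(** The difference of the two sides lies in the ideal of the two curve equations; the displayed
    cofactors certify this and [ring] checks them. The identities for commutativity and
    associativity are proved in the same way. *)
Lemma rot_on_curve x1 z1 x2 z2 : on_chart x1 z1 -> on_chart x2 z2 ->
  rotX x1 1 z1 x2 1 z2 ^+ 3 + rotY x1 1 z1 x2 1 z2 ^+ 3
    = k * rotZ x1 1 z1 x2 1 z2 ^+ 3.
Proof.
move=> /on_chartE e1 /on_chartE e2; apply/eqP; rewrite -subr_eq0; apply/eqP.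
transitivity
  ((x2^+6 - k*x2^+3*z2^+3 - 3*k*x1*z1*x2^+2*z2^+2 + k*x1^+3*x2^+3*z2^+3
     + k^+2*z1^+3*x2^+3*z2^+3 - k^+3*z1^+3*z2^+6)
     * (x1 ^+ 3 + 1 - k * z1 ^+ 3)
   + (-x2^+3 - k*z1^+3 + k*z1^+3*x2^+3 + 3*k*x1^+2*z1^+2*x2*z2
       - k^+2*z1^+3*z2^+3 + k^+3*z1^+6*z2^+3)
     * (x2 ^+ 3 + 1 - k * z2 ^+ 3)).
  by rewrite /rotX /rotY /rotZ; ring.
by rewrite e1 e2 !mulr0 addr0.
Qed.

(** The rotated formulas are not symmetric in the two points: the two orders agree only as
    projective points, hence the cross products with [rotY]. *)
Lemma rot_comm x1 z1 x2 z2 : on_chart x1 z1 -> on_chart x2 z2 ->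
  rotX x1 1 z1 x2 1 z2 * rotY x2 1 z2 x1 1 z1
    = rotX x2 1 z2 x1 1 z1 * rotY x1 1 z1 x2 1 z2 /\
  rotZ x1 1 z1 x2 1 z2 * rotY x2 1 z2 x1 1 z1
    = rotZ x2 1 z2 x1 1 z1 * rotY x1 1 z1 x2 1 z2.
Proof.
move=> /on_chartE e1 /on_chartE e2; split; apply/eqP; rewrite -subr_eq0;
  apply/eqP.
  transitivity (k*z1*x2*z2^+2 * (x1 ^+ 3 + 1 - k * z1 ^+ 3)
                - k*x1*z1^+2*z2 * (x2 ^+ 3 + 1 - k * z2 ^+ 3)).
    by rewrite /rotX /rotY; ring.
  by rewrite e1 e2 !mulr0 subr0.
transitivity (x2*z2 * (x1 ^+ 3 + 1 - k * z1 ^+ 3)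
              - x1*z1 * (x2 ^+ 3 + 1 - k * z2 ^+ 3)).
  by rewrite /rotZ /rotY; ring.
by rewrite e1 e2 !mulr0 subr0.
Qed.

Section Associativity.
Variables x1 z1 x2 z2 x3 z3 : K.
Hypotheses (h1 : on_chart x1 z1) (h2 : on_chart x2 z2) (h3 : on_chart x3 z3).

Let S12 (f : K -> K -> K -> K -> K -> K -> K) :=
  f (rotX x1 1 z1 x2 1 z2) (rotY x1 1 z1 x2 1 z2)
               (rotZ x1 1 z1 x2 1 z2) x3 1 z3.
Let S23 (f : K -> K -> K -> K -> K -> K -> K) :=
  f x1 1 z1 (rotX x2 1 z2 x3 1 z3) (rotY x2 1 z2 x3 1 z3)
               (rotZ x2 1 z2 x3 1 z3).

(** Both bracketings are compared as projective points, by cross-multiplication with their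
    Y-coordinates; [rotY_neq0] will allow the division. *)
Lemma rot_assocX : S12 rotX * S23 rotY = S23 rotX * S12 rotY.
Proof.
move: h1 h2 h3 => /on_chartE e1 /on_chartE e2 /on_chartE e3.
apply/eqP; rewrite -subr_eq0; apply/eqP.
transitivity
  ((k*x1*x2^+3*z2^+2*x3^+3*z3 - k*x1*x2^+5*z2*x3^+4*z3^+2 +
     2*k^+2*z1^+2*x2*z2^+3*z3 + k^+2*z1^+2*x2^+2*z2^+4*x3^+2 +
     k^+2*z1^+2*x2^+2*z2^+4*x3^+5 - 3*k^+2*z1^+2*x2^+3*z2^+2*x3*z3^+2 -
     k^+2*z1^+2*x2^+3*z2^+2*x3^+4*z3^+2 - 2*k^+2*z1^+2*x2^+4*z2^+3*x3^+3*z3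
     + k^+2*z1^+2*x2^+5*z2*x3^+2*z3^+3 + k^+2*z1^+2*x2^+6*z2^+2*x3^+4*z3^+2
     + k^+2*x1*x2^+2*z2^+4*x3*z3^+2 - k^+2*x1*x2^+4*z2^+3*x3^+2*z3^+3 -
     k^+2*x1^+2*z1*x2^+2*z2^+4*z3 + 2*k^+2*x1^+2*z1*x2^+4*z2^+3*x3*z3^+2 -
     k^+2*x1^+2*z1*x2^+6*z2^+2*x3^+2*z3^+3 + 2*k^+3*z1^+2*x2*z2^+6*x3^+3*z3
     - 2*k^+3*z1^+2*x2^+2*z2^+4*x3^+2*z3^+3 + k^+3*z1^+2*x2^+4*z2^+3*z3^+4 -
     k^+3*z1^+2*x2^+6*z2^+2*x3*z3^+5 + k^+4*z1^+2*z2^+8*x3*z3^+2 -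
     k^+4*z1^+2*x2*z2^+6*z3^+4)
     * (x1 ^+ 3 + 1 - k * z1 ^+ 3)
   + (k*z1^+2*x2*x3^+3*z3 + k*x1^+2*z1*z2^+2*x3^+2 + k*x1^+2*z1*z2^+2*x3^+5 -
     2*k*x1^+2*z1*x2^+2*z2*x3^+3*z3 + k*x1^+2*z1*x2^+4*x3^+4*z3^+2 +
     2*k^+2*z1^+2*z2^+2*x3*z3^+2 + k^+2*z1^+2*z2^+2*x3^+4*z3^+2 +
     2*k^+2*z1^+2*x2*z2^+3*x3^+3*z3 - k^+2*z1^+2*x2^+3*z2^+2*x3^+4*z3^+2 +
     k^+2*x1*z1^+3*z2^+2*x3^+3*z3 - k^+2*x1^+2*z1*z2^+2*x3^+2*z3^+3 -
     2*k^+2*x1^+2*z1*x2*z2^+3*x3*z3^+2 +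
     k^+2*x1^+2*z1*x2^+3*z2^+2*x3^+2*z3^+3 - k^+3*z1^+2*z2^+2*x3*z3^+5 -
     k^+3*z1^+2*z2^+5*x3^+4*z3^+2 - k^+3*z1^+2*x2*z2^+3*z3^+4 +
     k^+3*z1^+2*x2^+3*z2^+2*x3*z3^+5 - 3*k^+3*z1^+5*z2^+2*x3*z3^+2 -
     2*k^+3*z1^+5*z2^+2*x3^+4*z3^+2 - 2*k^+3*z1^+5*x2*z2^+3*x3^+3*z3 +
     k^+3*z1^+5*x2^+2*z2*x3^+2*z3^+3 + k^+3*z1^+5*x2^+3*z2^+2*x3^+4*z3^+2 -
     k^+3*x1*z1^+3*z2^+2*z3^+4 + k^+3*x1*z1^+3*x2*z2^+3*x3^+2*z3^+3 +
     k^+3*x1*z1^+3*x2^+2*z2*x3*z3^+5 + 2*k^+3*x1^+2*z1^+4*x2*z2^+3*x3*z3^+2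
     + k^+3*x1^+2*z1^+4*x2*z2^+3*x3^+4*z3^+2 -
     k^+3*x1^+2*z1^+4*x2^+3*z2^+2*x3^+2*z3^+3 + k^+4*z1^+2*z2^+5*x3*z3^+5 +
     2*k^+4*z1^+5*z2^+2*x3*z3^+5 + k^+4*z1^+5*z2^+5*x3^+4*z3^+2 +
     k^+4*z1^+5*x2*z2^+3*z3^+4 - k^+4*z1^+5*x2^+3*z2^+2*x3*z3^+5 -
     k^+4*x1^+2*z1^+4*x2*z2^+3*x3*z3^+5 - k^+5*z1^+5*z2^+5*x3*z3^+5)
     * (x2 ^+ 3 + 1 - k * z2 ^+ 3)
   + (-k*z1^+2*x2^+2*z2*x3^+2 - k*x1^+2*z1*z2^+2*x3^+2 -
     k^+2*z1^+2*z2^+2*x3*z3^+2 - 2*k^+2*z1^+2*x2*z2^+3*z3 -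
     k^+2*z1^+2*x2^+2*z2^+4*x3^+2 - k^+2*x1*z1^+3*z2^+2*z3 -
     k^+2*x1*z1^+3*x2*z2^+3*x3^+2 + k^+2*x1*z1^+3*x2^+2*z2*x3*z3^+2 +
     k^+2*x1^+2*z1*z2^+5*x3^+2 + k^+2*x1^+2*z1*x2^+2*z2^+4*z3 +
     2*k^+3*z1^+2*z2^+5*x3*z3^+2 + 2*k^+3*z1^+5*z2^+2*x3*z3^+2 +
     2*k^+3*z1^+5*x2*z2^+3*z3 + k^+3*z1^+5*x2^+2*z2^+4*x3^+2 -
     k^+3*x1*z1^+3*x2^+2*z2^+4*x3*z3^+2 - k^+3*x1^+2*z1^+4*x2*z2^+3*x3*z3^+2
     - k^+3*x1^+2*z1^+4*x2^+2*z2^+4*z3 - k^+4*z1^+2*z2^+8*x3*z3^+2 -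
     3*k^+4*z1^+5*z2^+5*x3*z3^+2 + k^+4*x1^+2*z1^+4*x2*z2^+6*x3*z3^+2 +
     k^+5*z1^+5*z2^+8*x3*z3^+2)
     * (x3 ^+ 3 + 1 - k * z3 ^+ 3)).
  by rewrite /S12 /S23 /rotX /rotY /rotZ; ring.
by rewrite e1 e2 e3 !mulr0 !addr0.
Qed.

Lemma rot_assocZ : S12 rotZ * S23 rotY = S23 rotZ * S12 rotY.
Proof.
move: h1 h2 h3 => /on_chartE e1 /on_chartE e2 /on_chartE e3.
apply/eqP; rewrite -subr_eq0; apply/eqP.
transitivity
  ((-k*z1*x2^+2*z2^+3 - k*z1*x2^+2*z2^+3*x3^+3 - 2*k*z1*x2^+3*z2*x3^+2*z3^+2
     + 3*k*z1*x2^+4*z2^+2*x3*z3 + 2*k*z1*x2^+4*z2^+2*x3^+4*z3 +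
     k*z1*x2^+5*x3^+3*z3^+3 - 3*k*z1*x2^+6*z2*x3^+2*z3^+2 +
     k*z1*x2^+8*x3^+3*z3^+3 + k*x1^+2*x2^+4*z2^+2*x3^+2*z3^+2 -
     k*x1^+2*x2^+6*z2*x3^+3*z3^+3 - k^+2*z1*x2*z2^+5*x3*z3 -
     k^+2*z1*x2^+2*z2^+3*z3^+3 + 3*k^+2*z1*x2^+3*z2^+4*x3^+2*z3^+2 -
     k^+2*z1*x2^+4*z2^+2*x3*z3^+4 - k^+2*x1*z1^+2*x2*z2^+5 -
     k^+2*x1*z1^+2*x2*z2^+5*x3^+3 + k^+2*x1*z1^+2*x2^+2*z2^+3*x3^+2*z3^+2 +
     2*k^+2*x1*z1^+2*x2^+3*z2^+4*x3*z3 + k^+2*x1*z1^+2*x2^+3*z2^+4*x3^+4*z3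
     - k^+2*x1*z1^+2*x2^+4*z2^+2*x3^+3*z3^+3 -
     k^+2*x1*z1^+2*x2^+5*z2^+3*x3^+2*z3^+2 + k^+2*x1^+2*x2^+3*z2^+4*z3^+3 -
     k^+2*x1^+2*x2^+5*z2^+3*x3*z3^+4 + k^+3*z1*x2^+2*z2^+6*z3^+3 -
     k^+3*z1*x2^+5*z2^+3*z3^+6 - k^+3*x1*z1^+2*z2^+7*x3*z3 +
     k^+3*x1*z1^+2*x2*z2^+5*z3^+3 + k^+3*x1*z1^+2*x2^+2*z2^+6*x3^+2*z3^+2 -
     k^+3*x1*z1^+2*x2^+3*z2^+4*x3*z3^+4)
     * (x1 ^+ 3 + 1 - k * z1 ^+ 3)
   + (-3*k*z1*x2*z2^+2*x3*z3 - 2*k*z1*x2*z2^+2*x3^+4*z3 +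
     3*k*z1*x2^+3*z2*x3^+2*z3^+2 - k*z1*x2^+5*x3^+3*z3^+3 -
     2*k*x1*z1^+2*z2*x3*z3 - 2*k*x1*z1^+2*z2*x3^+4*z3 +
     k*x1*z1^+2*x2^+2*x3^+2*z3^+2 + 2*k^+2*z1*x2*z2^+2*x3*z3^+4 -
     k^+2*z1*x2^+2*z2^+3*x3^+3*z3^+3 + k^+2*z1^+4*z2*x3^+2*z3^+2 +
     3*k^+2*z1^+4*x2*z2^+2*x3*z3 + 2*k^+2*z1^+4*x2*z2^+2*x3^+4*z3 -
     3*k^+2*z1^+4*x2^+3*z2*x3^+2*z3^+2 + k^+2*z1^+4*x2^+5*x3^+3*z3^+3 +
     2*k^+2*x1*z1^+2*z2*x3*z3^+4 - 2*k^+2*x1*z1^+2*z2^+4*x3*z3 -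
     k^+2*x1*z1^+2*z2^+4*x3^+4*z3 - k^+2*x1*z1^+2*x2*z2^+2*x3^+3*z3^+3 +
     k^+2*x1*z1^+2*x2^+2*z2^+3*x3^+2*z3^+2 -
     2*k^+2*x1^+2*z1^+3*x2*z2^+2*x3^+2*z3^+2 +
     k^+2*x1^+2*z1^+3*x2^+3*z2*x3^+3*z3^+3 + k^+3*z1*x2^+2*z2^+3*z3^+6 -
     k^+3*z1^+4*x2*z2^+2*x3*z3^+4 + k^+3*z1^+4*x2^+2*z2^+3*x3^+3*z3^+3 +
     k^+3*x1*z1^+2*z2^+4*x3*z3^+4 + k^+3*x1*z1^+2*x2*z2^+2*z3^+6 +
     2*k^+3*x1*z1^+5*z2^+4*x3*z3 + k^+3*x1*z1^+5*z2^+4*x3^+4*z3 -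
     k^+3*x1*z1^+5*x2^+2*z2^+3*x3^+2*z3^+2 + k^+3*x1^+2*z1^+3*z2^+4*z3^+3 +
     k^+3*x1^+2*z1^+3*z2^+4*x3^+3*z3^+3 -
     k^+3*x1^+2*z1^+3*x2^+2*z2^+3*x3*z3^+4 - k^+4*z1^+4*x2^+2*z2^+3*z3^+6 -
     k^+4*x1*z1^+5*z2^+4*x3*z3^+4 - k^+4*x1^+2*z1^+3*z2^+4*z3^+6)
     * (x2 ^+ 3 + 1 - k * z2 ^+ 3)
   + (2*k*z1*x2*z2^+2*x3*z3 + k*z1*x2^+2*z2^+3 + 2*k*x1*z1^+2*z2*x3*z3 +
     k*x1*z1^+2*x2*z2^+2 - 2*k^+2*z1*x2*z2^+5*x3*z3 +
     k^+2*z1*x2^+2*z2^+3*z3^+3 - 3*k^+2*z1^+4*x2*z2^+2*x3*z3 -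
     k^+2*z1^+4*x2^+2*z2^+3 - k^+2*x1*z1^+2*z2^+4*x3*z3 +
     k^+2*x1*z1^+2*x2*z2^+2*z3^+3 + k^+2*x1*z1^+2*x2*z2^+5 +
     k^+2*x1^+2*z1^+3*z2^+4 - k^+3*z1*x2^+2*z2^+6*z3^+3 +
     2*k^+3*z1^+4*x2*z2^+5*x3*z3 - 2*k^+3*z1^+4*x2^+2*z2^+3*z3^+3 -
     k^+3*x1*z1^+2*z2^+7*x3*z3 - k^+3*x1*z1^+2*x2*z2^+5*z3^+3 -
     k^+3*x1*z1^+5*z2^+4*x3*z3 - k^+3*x1*z1^+5*x2*z2^+5 -
     k^+3*x1^+2*z1^+3*z2^+4*z3^+3 + k^+4*z1^+4*x2^+2*z2^+6*z3^+3 +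
     k^+4*x1*z1^+5*z2^+7*x3*z3 + k^+4*x1^+2*z1^+3*z2^+7*z3^+3)
     * (x3 ^+ 3 + 1 - k * z3 ^+ 3)).
  by rewrite /S12 /S23 /rotX /rotY /rotZ; ring.
by rewrite e1 e2 e3 !mulr0 !addr0.
Qed.

End Associativity.
End RotatedLaw.
(** Bundling k with the proof that it is no cube lets the type [point k] carry its group structure,
    whose addition divides by quantities that are nonzero for this reason. *)
Record noncube (K : fieldType) :=
  NonCube { noncube_val :> K; noncubeP : forall x, x ^+ 3 != noncube_val }.

Section PointGroup.
Variables (K : fieldType) (k : noncube K).
Local Notation kv := (noncube_val k).

(* As k is not a cube, every K-point of X^3 + Y^3 = k Z^3 has Y != 0, so that
   (X / Y, Z / Y) are global coordinates. *)
Record point := Point {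
  pcoord :> K * K; pcoordP : on_chart kv pcoord.1 pcoord.2 }.

HB.instance Definition _ := [isSub for pcoord].
HB.instance Definition _ := [Choice of point by <:].

Lemma point_eq (P Q : point) : P.1 = Q.1 -> P.2 = Q.2 -> P = Q.
Proof. by move=> e1 e2; apply: val_inj; apply: injective_projections. Qed.

Lemma pointE (P : point) : P.1 ^+ 3 + 1 = kv * P.2 ^+ 3.
Proof. exact/eqP/(pcoordP P). Qed.

Lemma cube_eq_noncube x z : x ^+ 3 = kv * z ^+ 3 -> x = 0 /\ z = 0.
Proof.
have [-> | z0] := eqVneq z 0.
  by rewrite expr0n mulr0 => /eqP; rewrite expf_eq0 /= => /eqP.
move=> e; case/negP: (noncubeP k (x / z)).
by rewrite expr_div_n e mulfK // expf_neq0.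
Qed.

Lemma noncube_neq0 : kv != 0.
Proof. by have := noncubeP k 0; rewrite expr0n eq_sym. Qed.

Lemma point_neq0 (P : point) : P.1 != 0.
Proof.
apply/eqP => x0; have := pointE P; rewrite x0 expr0n add0r => e.
have [/eqP] : (1 : K) = 0 /\ P.2 = 0 by apply: cube_eq_noncube; rewrite expr1n.
by rewrite oner_eq0.
Qed.

Local Notation sumX P Q := (rotX kv P.1 1 P.2 Q.1 1 Q.2).
Local Notation sumY P Q := (rotY kv P.1 1 P.2 Q.1 1 Q.2).
Local Notation sumZ P Q := (rotZ P.1 1 P.2 Q.1 1 Q.2).

(** If Y vanishes, the curve equation reads X^3 = k Z^3 and forces X = Z = 0. The three vanishing
    coordinates combine into (x1 x2)^3 = k (-z1)^3, so that x1 x2 = 0, against [point_neq0]. *)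
Lemma rotY_neq0 (P Q : point) : sumY P Q != 0.
Proof.
have x1 := point_neq0 P; have x2 := point_neq0 Q.
apply/eqP => Y0; have := rot_on_curve (pcoordP P) (pcoordP Q).
rewrite Y0 expr0n addr0 => /cube_eq_noncube [X0 Z0].
have eY : Q.1 = - (kv * Q.2 ^+ 2 * P.2 * P.1).
  by apply/eqP; rewrite -subr_eq0 -oppr_eq0 -Y0 /rotY; apply/eqP; ring.
have eZ : P.2 = P.1 ^+ 2 * Q.2 * Q.1.
  by apply/eqP; rewrite -subr_eq0 -Z0 /rotZ; apply/eqP; ring.
have [e _] : P.1 * Q.1 = 0 /\ - P.2 = 0.
  apply: cube_eq_noncube.
  have -> : (P.1 * Q.1) ^+ 3 = P.1 ^+ 2 * Q.1 * (Q.1 ^+ 2 * P.1) by ring.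
  have -> : Q.1 ^+ 2 * P.1 = - (kv * P.2 ^+ 2 * Q.2).
    by apply/eqP; rewrite -subr_eq0 -X0 /rotX; apply/eqP; ring.
  transitivity (- (kv * P.2 ^+ 2 * (P.1 ^+ 2 * Q.2 * Q.1))); first by ring.
  by rewrite -eZ; ring.
by move/eqP: e; rewrite mulf_eq0 (negPf x1) (negPf x2).
Qed.

Lemma padd_subproof (P Q : point) :
  on_chart kv (sumX P Q / sumY P Q)
             (sumZ P Q / sumY P Q).
Proof.
have Y0 := rotY_neq0 P Q; rewrite /on_chart !expr_div_n mulrA.
rewrite -(rot_on_curve (pcoordP P) (pcoordP Q)).
by rewrite mulrDl divff // expf_neq0.
Qed.

Definition padd P Q := @Point (_, _) (padd_subproof P Q).

Lemma pzero_subproof : on_chart kv (-1) 0.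
Proof. by rewrite /on_chart expr0n mulr0 -signr_odd expr1 addNr. Qed.

Definition pzero := @Point (-1, 0) pzero_subproof.

Lemma popp_subproof (P : point) : on_chart kv P.1^-1 (P.2 / P.1).
Proof.
rewrite /on_chart expr_div_n mulrA -pointE mulrDl mul1r divff.
  by rewrite exprVn addrC.
by rewrite expf_neq0 // point_neq0.
Qed.

Definition popp P := @Point (_, _) (popp_subproof P).

Lemma paddC : commutative padd.
Proof.
move=> P Q; have [eX eZ] := rot_comm (pcoordP P) (pcoordP Q).
by apply: point_eq => /=; apply/eqP;
  rewrite eqr_div ?rotY_neq0 ?eX ?eZ.
Qed.

Lemma padd0 : left_id pzero padd.
Proof.
move=> P; have x0 := point_neq0 P.
have eY : sumY pzero P = - P.1 by rewrite /rotY /=; ring.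
by apply: point_eq; rewrite /padd /= eY /rotX /rotZ /=; field; rewrite oppr_eq0.
Qed.

Lemma paddN : left_inverse pzero popp padd.
Proof.
move=> P; have x0 := point_neq0 P; have Y0 := rotY_neq0 (popp P) P.
have eX : sumX (popp P) P = - sumY (popp P) P.
  by rewrite /rotX /rotY /=; field.
have eZ : sumZ (popp P) P = 0 by rewrite /rotZ /=; field.
by apply: point_eq; rewrite /padd /= ?eX ?eZ ?mul0r // mulNr divff.
Qed.

Lemma paddA : associative padd.
Proof.
move=> P Q R; apply: esym.
have YS := rotY_neq0 P Q; have YT := rotY_neq0 Q R.
have YL := rotY_neq0 (padd P Q) R; have YR := rotY_neq0 P (padd Q R).
have eX := rot_assocX (pcoordP P) (pcoordP Q) (pcoordP R).
have eZ := rot_assocZ (pcoordP P) (pcoordP Q) (pcoordP R).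
(* The formulas are homogeneous of degree 2 in each point, so normalising an intermediate sum to Y =
   1 scales all three coordinates by the same factor. *)
have homl (X Y Z x z : K) : Y != 0 ->
  [/\ rotX kv (X / Y) 1 (Z / Y) x 1 z = rotX kv X Y Z x 1 z / Y ^+ 2,
      rotY kv (X / Y) 1 (Z / Y) x 1 z = rotY kv X Y Z x 1 z / Y ^+ 2 &
      rotZ (X / Y) 1 (Z / Y) x 1 z = rotZ X Y Z x 1 z / Y ^+ 2].
  by move=> Y0; split; rewrite /rotX /rotY /rotZ; field.
have homr (X Y Z x z : K) : Y != 0 ->
  [/\ rotX kv x 1 z (X / Y) 1 (Z / Y) = rotX kv x 1 z X Y Z / Y ^+ 2,
      rotY kv x 1 z (X / Y) 1 (Z / Y) = rotY kv x 1 z X Y Z / Y ^+ 2 &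
      rotZ x 1 z (X / Y) 1 (Z / Y) = rotZ x 1 z X Y Z / Y ^+ 2].
  by move=> Y0; split; rewrite /rotX /rotY /rotZ; field.
have [eXl eYl eZl] := homl (sumX P Q) _ (sumZ P Q) R.1 R.2 YS.
have [eXr eYr eZr] := homr (sumX Q R) _ (sumZ Q R) P.1 P.2 YT.
rewrite /= eYl mulf_eq0 negb_or in YL; rewrite /= eYr mulf_eq0 negb_or in YR.
case/andP: YL => YL iS; case/andP: YR => YR iT.
have cancel (a b c d s t : K) : b != 0 -> d != 0 -> s != 0 -> t != 0 ->
    a * d = c * b -> a / s / (b / s) = c / t / (d / t).
  move=> b0 d0 s0 t0 e.
  transitivity (a / b); first by field; rewrite ?b0 ?s0.
  transitivity (c / d); last by field; rewrite ?d0 ?t0.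
  by apply/eqP; rewrite eqr_div // e.
by rewrite !invr_eq0 in iS iT; apply: point_eq;
  rewrite /= eYl eYr ?eXl ?eXr ?eZl ?eZr; apply: cancel.
Qed.

HB.instance Definition _ := GRing.isZmodule.Build point paddA paddC padd0 paddN.

End PointGroup.

(** * Change of base field *)

Section PointMap.
Variables (K0 K : fieldType) (phi : {rmorphism K0 -> K}).
Variables (k0 : noncube K0) (k : noncube K).
Hypothesis phi_k : phi (noncube_val k0) = noncube_val k.

Lemma pmap_subproof (P : point k0) : on_chart (noncube_val k) (phi P.1) (phi P.2).
Proof.
by rewrite /on_chart -phi_k -!rmorphXn -rmorphM -pointE rmorphD rmorph1.
Qed.

Definition pmap P := @Point K k (_, _) (pmap_subproof P).

Lemma pmapD : {morph pmap : P Q / P + Q}.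
Proof.
by move=> P Q; apply: point_eq => /=;
  rewrite fmorph_div /rotX /rotY /rotZ;
  rewrite !(rmorphD, rmorphB, rmorphN, rmorphM, rmorphXn, rmorph1) phi_k.
Qed.

Lemma pmap_inj : injective pmap.
Proof.
by move=> P Q [/fmorph_inj e1 /fmorph_inj e2]; apply: point_eq.
Qed.

Lemma pmap0 : pmap 0 = 0.
Proof. by apply: (addrI (pmap 0)); rewrite -pmapD !addr0. Qed.

Lemma pmapB : {morph pmap : P Q / P - Q}.
Proof.
by move=> P Q; apply: (addIr (pmap Q)); rewrite -pmapD !subrK.
Qed.

HB.instance Definition _ := GRing.isZmodMorphism.Build _ _ pmap pmapB.

End PointMap.

(** * Agreement with the chord-and-tangent law *)

Section AffinePoints.
Variables (K : fieldType) (k : noncube K).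
Local Notation kv := (noncube_val k).
Hypothesis no_w : forall m : K, m ^+ 2 - m + 1 != 0.

(** Change of chart: affine points are normalised by Z = 1, elements of [point k] by Y = 1. *)
Definition cpoint_rel (P : cpoint K) (p : point k) :=
  if P is Some (x, y) then [/\ y != 0, p.1 = x / y & p.2 = y^-1] else p = 0.

Lemma cpoint_rel_ex P : on_cubic kv P -> exists p, cpoint_rel P p.
Proof.
case: P => [[x y] /eqP e|_]; last by exists 0.
have y0 : y != 0.
  by apply/eqP => y0; have := noncubeP k x; rewrite -e y0 expr0n addr0 eqxx.
have H : on_chart kv (x / y) y^-1.
  by rewrite /on_chart -e; apply/eqP; field.
by exists (@Point K k (_, _) H).
Qed.

Lemma cpoint_rel_on_cubic P p : cpoint_rel P p -> on_cubic kv P.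
Proof.
case: P => [[x y] [y0 ex ey]|//] /=; have := pointE p; rewrite ex ey => e.
rewrite -(inj_eq (mulIf (expf_neq0 3 (invr_neq0 y0)))) -e; apply/eqP; field.
exact: y0.
Qed.

Lemma cpoint_rel_eq0 P p : cpoint_rel P p -> (p == 0) = (P == None).
Proof.
case: P => [[x y] [y0 ex ey]|->] /=; last by rewrite !eqxx.
apply/negbTE/eqP => p0; move: ey; rewrite p0 /= => /esym/eqP.
by rewrite invr_eq0 (negPf y0).
Qed.

Lemma cpoint_rel_opp P p : cpoint_rel P p -> cpoint_rel (cneg P) (- p).
Proof.
case: P => [[x y] [y0 ex ey]|->] /=; last by rewrite oppr0.
have x0 : x != 0.
  by move: (point_neq0 p); rewrite ex mulf_eq0 negb_or => /andP[].
by split; rewrite // ex ?ey; field; rewrite x0 y0.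
Qed.

Lemma point_eq0 (p : point k) : (p == 0) = (p.2 == 0).
Proof.
apply/eqP/eqP => [-> //|z0]; apply: point_eq => //=.
have := pointE p; rewrite z0 expr0n mulr0.
have -> : p.1 ^+ 3 + 1 = (p.1 + 1) * (p.1 ^+ 2 - p.1 + 1) by ring.
by move/eqP; rewrite mulf_eq0 (negPf (no_w _)) orbF addr_eq0 => /eqP.
Qed.

Section Sum.
Variables (x1 y1 x2 y2 : K) (p q : point k).
Hypotheses (rel_p : cpoint_rel (Some (x1, y1)) p).
Hypotheses (rel_q : cpoint_rel (Some (x2, y2)) q).

Let scaled : [/\ rotX kv p.1 1 p.2 q.1 1 q.2
                   = rotX kv x1 y1 1 x2 y2 1 / (y1 * y2) ^+ 2,
                 rotY kv p.1 1 p.2 q.1 1 q.2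
                   = rotY kv x1 y1 1 x2 y2 1 / (y1 * y2) ^+ 2 &
                 rotZ p.1 1 p.2 q.1 1 q.2
                   = rotZ x1 y1 1 x2 y2 1 / (y1 * y2) ^+ 2].
Proof.
case: rel_p rel_q => y10 -> -> [y20 -> ->].
by split; rewrite /rotX /rotY /rotZ; field; rewrite y10 y20.
Qed.

Lemma cpoint_rel_sum_None :
  rotZ x1 y1 1 x2 y2 1 = 0 -> cpoint_rel None (p + q).
Proof.
case: scaled => _ _ eZ Z0; apply/eqP.
by rewrite point_eq0 /= eZ Z0 !mul0r.
Qed.

(** Here [rotZ] is nonzero because the second equation makes it a factor of [rotY], which never
    vanishes. *)
Lemma cpoint_rel_sum_Some X Y :
  X * rotZ x1 y1 1 x2 y2 1 = rotX kv x1 y1 1 x2 y2 1 ->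
  Y * rotZ x1 y1 1 x2 y2 1 = rotY kv x1 y1 1 x2 y2 1 ->
  cpoint_rel (Some (X, Y)) (p + q).
Proof.
case: scaled (rotY_neq0 p q) => eX eY eZ + e1 e2.
rewrite eY mulf_eq0 negb_or -e2 mulf_eq0 negb_or.
case/andP=> /andP[Y0 Z0] _; have [[y10 _ _] [y20 _ _]] := (rel_p, rel_q).
by split; rewrite //= ?eX ?eY ?eZ -?e1 -?e2; field;
  rewrite y10 y20 Y0 Z0.
Qed.

Lemma cpoint_rel_add :
  cpoint_rel (cadd (Some (x1, y1)) (Some (x2, y2))) (p + q).
Proof.
have k0 := noncube_neq0 k.
have [[y10 _ _] [y20 _ _]] := (rel_p, rel_q).
have /eqP e1 := cpoint_rel_on_cubic rel_p.
have /eqP e2 := cpoint_rel_on_cubic rel_q.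
have cube1 m : m != -1 -> 1 + m ^+ 3 != 0 :> K.
  have -> : 1 + m ^+ 3 = (m + 1) * (m ^+ 2 - m + 1) by ring.
  by rewrite mulf_eq0 (negPf (no_w m)) orbF addr_eq0.
have n3 : 3%:R != 0 :> K.
  by have := no_w (-1); congr (_ != _); ring.
rewrite /=; case: ifP => [/andP[/eqP ex /eqP ey]|].
  rewrite (negPf y10) /cchord.
  have Z : rotZ x1 y1 1 x2 y2 1 = y1 ^+ 3 - x1 ^+ 3 by rewrite /rotZ -ex -ey; ring.
  case: ifP => [/eqP em | /negbT/cube1 nm].
    apply: cpoint_rel_sum_None; rewrite Z.
    have /eqP : (y1 - x1) * (y1 + x1) = 0.
      have -> : (y1 - x1) * (y1 + x1)
                = y1 ^+ 2 * (1 + - (x1 ^+ 2 / y1 ^+ 2)) by field.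
      by rewrite em addrN mulr0.
    rewrite mulf_eq0 => /orP[|/eqP s0].
      by rewrite subr_eq0 => /eqP->; rewrite subrr.
    case/eqP: k0; rewrite -e1.
    have -> : x1 ^+ 3 + y1 ^+ 3
              = (y1 + x1) * (x1 ^+ 2 - x1 * y1 + y1 ^+ 2) by ring.
    by rewrite s0 mul0r.
  set m := - _ in nm *.
  have eD : 1 + m ^+ 3 = (y1 ^+ 3 - x1 ^+ 3) * kv / y1 ^+ 6.
    by rewrite /m -e1; field.
  move: nm; rewrite eD !mulf_eq0 !negb_or => /andP[/andP[D0 _] _].
  have ek : y1 - m * x1 = kv / y1 ^+ 2 by rewrite /m -e1; field.
  rewrite -e1 in k0 *; rewrite ek -e1.
  by apply: cpoint_rel_sum_Some; rewrite Z /rotX /rotY -ex -ey -e1 /m; field;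
    rewrite k0 D0 y10.
have rel1 : x1 ^+ 3 + y1 ^+ 3 - kv = 0 by rewrite e1 subrr.
have rel2 : x2 ^+ 3 + y2 ^+ 3 - kv = 0 by rewrite e2 subrr.
move=> nxy; case: ifP => [/eqP ex | nx].
  (* Two points with equal x and different y would make y1 / y2 a primitive cube root of unity, so
     this branch is void. *)
  move: nxy; rewrite ex eqxx /= => /negbT ny; case/negP: (no_w (- (y1 / y2))).
  have : (y1 - y2) * (y1 ^+ 2 + y1 * y2 + y2 ^+ 2) = 0.
    by transitivity (x1 ^+ 3 + y1 ^+ 3 - (x2 ^+ 3 + y2 ^+ 3));
      [rewrite ex; ring | rewrite e1 e2 subrr].
  move/eqP; rewrite mulf_eq0 subr_eq0 (negPf ny) /= => /eqP e.
  apply/eqP; transitivity ((y1 ^+ 2 + y1 * y2 + y2 ^+ 2) / y2 ^+ 2).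
    by field.
  by rewrite e mul0r.
rewrite /cchord; set m := (y2 - y1) / (x2 - x1).
have d0 : x2 - x1 != 0 by rewrite subr_eq0 eq_sym nx.
have em : m * (x2 - x1) = y2 - y1 by rewrite divfK.
case: ifP => [/eqP m1 | /negbT/cube1 nm].
  apply: cpoint_rel_sum_None.
  have ey : y2 = x1 + y1 - x2.
    by apply/eqP; rewrite -subr_eq0 -(subr_eq0 _ _); apply/eqP; 
       transitivity (y2 - y1 + (x2 - x1)); [ring | rewrite -em m1; ring].
  have s0 : x1 + y1 != 0.
    apply: contraNneq k0 => s0; rewrite -e1.
    have -> : x1 ^+ 3 + y1 ^+ 3
              = (x1 + y1) * (x1 ^+ 2 - x1 * y1 + y1 ^+ 2) by ring.
    by rewrite s0 mul0r.
  (* With x1 + y1 = x2 + y2 the two curve equations differ by this product. Only x2 = y1 is left, so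
     the second point is the opposite of the first. *)
  have : 3%:R * (x1 + y1) * ((x2 - x1) * (x2 - y1)) = 0.
    transitivity (x2 ^+ 3 + y2 ^+ 3 - kv - (x1 ^+ 3 + y1 ^+ 3 - kv)).
      by rewrite ey; ring.
    by rewrite rel1 rel2 subrr.
  move/eqP; rewrite !mulf_eq0 (negPf n3) (negPf s0) (negPf d0) /= subr_eq0.
  by move=> /eqP ex; rewrite /rotZ ey ex; ring.
set e := y2 - y1; set d := x2 - x1.
have eD : 1 + m ^+ 3 = (d ^+ 3 + e ^+ 3) / d ^+ 3 by rewrite /m -/d -/e; field.
move: nm; rewrite eD mulf_eq0 negb_or => /andP[D0 _].
have eb : y1 - m * x1 = (y1 * x2 - y2 * x1) / d.
  by rewrite /m /d; field.
rewrite eb; set t := y1 * x2 - y2 * x1.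
set Y := - _ / _ - x1 - x2.
have eY : Y = (- 3%:R * e ^+ 2 * t - (x1 + x2) * (d ^+ 3 + e ^+ 3))
              / (d ^+ 3 + e ^+ 3).
  by rewrite /Y /m -/d -/e; field; rewrite D0 d0.
apply: cpoint_rel_sum_Some.
  have -> : m * Y + t / d
    = (e * (- 3%:R * e ^+ 2 * t - (x1 + x2) * (d ^+ 3 + e ^+ 3))
       + t * (d ^+ 3 + e ^+ 3)) / (d * (d ^+ 3 + e ^+ 3)).
    by rewrite eY /m -/d -/e; field; rewrite D0 d0.
  apply: (mulfI (mulf_neq0 d0 D0)); rewrite mulrA mulrCA divff ?mulf_neq0 //.
  apply/eqP; rewrite mulr1 -subr_eq0; apply/eqP.
  transitivity
    ((-2*y1*x2*y2^+3 + y1^+2*x2*y2^+2 - 3*x1*x2^+3*y2 + 2*x1*y1*y2^+3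
      + x1*y1*x2^+3 - x1*y1^+2*y2^+2 + 5*x1^+2*x2^+2*y2 - 2*x1^+2*y1*x2^+2
      - 2*x1^+3*x2*y2 + x1^+3*y1*x2 + kv*x2*y2 - kv*x1*y2)
        * (x1 ^+ 3 + y1 ^+ 3 - kv)
     + (-y1*x2*y2^+3 + 2*y1^+2*x2*y2^+2 + x1*y1*y2^+3 - x1*y1*x2^+3
      - 2*x1*y1^+2*y2^+2 + x1^+2*x2^+2*y2 + 2*x1^+2*y1*x2^+2 - x1^+3*x2*y2
      - x1^+3*y1*x2 - kv*x2*y2 + kv*x1*y2) * (x2 ^+ 3 + y2 ^+ 3 - kv)).
    by rewrite /rotX /rotZ /t /d /e; ring.
  by rewrite rel1 rel2 !mulr0 addr0.
rewrite eY; apply: (mulfI D0); rewrite mulrA mulrCA divff //.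
apply/eqP; rewrite mulr1 -subr_eq0; apply/eqP.
transitivity
  ((y1*x2*y2^+2 - y1^+2*x2*y2 + x1*y1*y2^+2 + 2*x1^+2*x2^+2 - x1^+3*x2
    - kv*x1) * (x1 ^+ 3 + y1 ^+ 3 - kv)
   + (-y1*x2*y2^+2 + y1^+2*x2*y2 + 2*x1*y1*y2^+2 - 3*x1*y1^+2*y2
      + x1^+2*x2^+2 - 2*x1^+3*x2 + kv*x1) * (x2 ^+ 3 + y2 ^+ 3 - kv)).
  by rewrite /rotY /rotZ /t /d /e; ring.
by rewrite rel1 rel2 !mulr0 addr0.
Qed.

End Sum.
End AffinePoints.
Section LinearCombinations.
Variables (K : fieldType) (k : noncube K).
Hypothesis no_w : forall m : K, m ^+ 2 - m + 1 != 0.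
Local Notation rel := (@cpoint_rel K k).

Lemma cpoint_rel_cadd P p Q q :
  rel P p -> rel Q q -> rel (cadd P Q) (p + q).
Proof.
case: P => [[x1 y1]|-> relQ]; last by rewrite add0r; case: Q relQ.
case: Q => [[x2 y2]|relP ->]; last by rewrite addr0.
by move=> relP relQ; apply: cpoint_rel_add.
Qed.

Lemma cpoint_rel_cmul P p n : rel P p -> rel (cmul n P) (p *~ n).
Proof.
move=> relP; have H m : rel (iter m (cadd P) None) (p *+ m).
  elim: m => [|m IHm] //; rewrite mulrS iterS; exact: cpoint_rel_cadd.
case: n => n; first exact: H.
by rewrite NegzE mulrNz; apply: cpoint_rel_opp; apply: H.
Qed.

Lemma cpoint_rel_clincomb ns Ps ps : size ps = size Ps ->
  (forall i, (i < size Ps)%N -> rel (nth None Ps i) ps`_i) ->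
  size ns = size Ps ->
  rel (clincomb ns Ps) (\sum_(i < size Ps) ps`_i *~ ns`_i).
Proof.
elim: Ps ps ns => [|P Ps IH] [|p ps] // [|n ns] //.
  by move=> *; rewrite big_ord0.
move=> [szp] relPs [szn]; rewrite big_ord_recl /clincomb /=.
apply: cpoint_rel_cadd; first by apply: cpoint_rel_cmul; apply: (relPs 0%N).
by apply: IH => // i lti; apply: (relPs i.+1).
Qed.

End LinearCombinations.

(** * Complex multiplication by Z[w] and the points at infinity *)

Section ComplexMultiplication.
Variables (K : fieldType) (k : noncube K) (w : K).
Local Notation kv := (noncube_val k).
Hypothesis w_root : w ^+ 2 + w + 1 = 0.

Lemma w_sqr : w ^+ 2 = - w - 1.
Proof. by apply/eqP; rewrite -subr_eq0; apply/eqP; rewrite -w_root; ring. Qed.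

Lemma w_cube : w ^+ 3 = 1.
Proof.
apply/eqP; rewrite -subr_eq0; apply/eqP.
by transitivity ((w - 1) * (w ^+ 2 + w + 1)); [ring | rewrite w_root mulr0].
Qed.

Lemma w_neq0 : w != 0.
Proof.
by apply: contraTneq (oner_neq0 K) => w0; rewrite -w_cube w0 expr0n eqxx.
Qed.

Lemma omega_subproof (P : point k) : on_chart kv P.1 (w ^+ 2 * P.2).
Proof.
by rewrite /on_chart pointE exprMn -exprM mulnC exprM w_cube expr1n mul1r.
Qed.

(** Scaling Z by w^2 = w^-1 is (x, y) -> (w x, w y) on affine points. *)
Definition omega P := @Point K k (_, _) (omega_subproof P).

Lemma omegaD : {morph omega : P Q / P + Q}.
Proof.
have w6 : w ^+ 6 = 1 by rewrite (exprM w 3 2) w_cube expr1n.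
move=> P Q.
have eX : rotX kv P.1 1 (w ^+ 2 * P.2) Q.1 1 (w ^+ 2 * Q.2)
          = rotX kv P.1 1 P.2 Q.1 1 Q.2.
  rewrite /rotX; congr (_ + _ * 1).
  by transitivity (w ^+ 6 * (kv * P.2 ^+ 2 * Q.2)); [ring | rewrite w6 mul1r].
have eY : rotY kv P.1 1 (w ^+ 2 * P.2) Q.1 1 (w ^+ 2 * Q.2)
          = rotY kv P.1 1 P.2 Q.1 1 Q.2.
  rewrite /rotY; congr (_ - _).
  by transitivity (w ^+ 6 * (- kv * Q.2 ^+ 2 * P.2 * P.1));
    [ring | rewrite w6 mul1r].
have eZ : rotZ P.1 1 (w ^+ 2 * P.2) Q.1 1 (w ^+ 2 * Q.2)
          = w ^+ 2 * rotZ P.1 1 P.2 Q.1 1 Q.2 by rewrite /rotZ; ring.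
by apply: point_eq; rewrite /= ?eX eY ?eZ // mulrA.
Qed.

Lemma omegaB : {morph omega : P Q / P - Q}.
Proof. by move=> P Q; apply: (addIr (omega Q)); rewrite -omegaD !subrK. Qed.

HB.instance Definition _ := GRing.isZmodMorphism.Build _ _ omega omegaB.

Lemma omega3 P : omega (omega (omega P)) = P.
Proof.
apply: point_eq => //.
transitivity ((w ^+ 3) ^+ 2 * P.2); first by rewrite /=; ring.
by rewrite w_cube expr1n mul1r.
Qed.

(* P, omega P and omega (omega P) lie on a line through [0 : 0 : 1]. *)
Lemma omega_sum P : P + omega P + omega (omega P) = 0.
Proof.
apply/eqP; rewrite addr_eq0; apply/eqP.
have x0 := point_neq0 P; have Y0 := rotY_neq0 P (omega P).
have eP := pointE P; have w3 := w_cube.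
have eY : rotY kv P.1 1 P.2 P.1 1 (w ^+ 2 * P.2)
          = - P.1 * (1 + w * (kv * P.2 ^+ 3)).
  by rewrite /rotY; transitivity
    (- P.1 * (1 + w ^+ 3 * w * (kv * P.2 ^+ 3))); [ring | rewrite w3 mul1r].
have eX : rotX kv P.1 1 P.2 P.1 1 (w ^+ 2 * P.2)
          = - (1 + w * (kv * P.2 ^+ 3)).
  transitivity (P.1 ^+ 3 + w ^+ 2 * (kv * P.2 ^+ 3)).
    by rewrite /rotX; ring.
  by rewrite -eP w_sqr; ring.
have eZ : rotZ P.1 1 P.2 P.1 1 (w ^+ 2 * P.2)
          = - (w * P.2 * (1 + w * (kv * P.2 ^+ 3))).
  transitivity (P.2 - P.1 ^+ 3 * w ^+ 2 * P.2).
    by rewrite /rotZ; ring.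
  have -> : P.1 ^+ 3 = kv * P.2 ^+ 3 - 1 by rewrite -eP; ring.
  transitivity (P.2 * (1 + w ^+ 2) - w ^+ 2 * (kv * P.2 ^+ 3) * P.2);
    first by ring.
  have -> : 1 + w ^+ 2 = - w by rewrite w_sqr; ring.
  by ring.
move: Y0; rewrite eY mulf_eq0 oppr_eq0 negb_or => /andP[_ n0].
apply: point_eq; rewrite /= eY ?eX ?eZ.
  by field; rewrite oppr_eq0 x0 n0.
transitivity (w ^+ 3 * w * P.2 / P.1); last by field.
by rewrite w3; field; rewrite oppr_eq0 x0 n0.
Qed.

Definition sqrtm3 P := omega P - omega (omega P).

Lemma sqrtm3B : {morph sqrtm3 : P Q / P - Q}.
Proof. by move=> P Q; rewrite /sqrtm3 !omegaB opprD addrACA -opprD. Qed.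

HB.instance Definition _ := GRing.isZmodMorphism.Build _ _ sqrtm3 sqrtm3B.

(** As k z^3 = x^3 + 1, the first coordinate is a fractional linear function of x^3. This cubic
    shape gives the exact factor 3 on heights and shows which cubes a preimage must supply. *)
Lemma sqrtm3_coord (P : point k) : [/\ 1 + w * (kv * P.2 ^+ 3) != 0,
  (sqrtm3 P).1 = - (1 + w ^+ 2 * (kv * P.2 ^+ 3)) / (1 + w * (kv * P.2 ^+ 3))
  & (sqrtm3 P).2
    = (w - w ^+ 2) * P.1 * P.2 / (1 + w * (kv * P.2 ^+ 3))].
Proof.
have x0 := point_neq0 P; have Y0 := rotY_neq0 (omega P) (- omega (omega P)).
have w3 := w_cube.
have eY : rotY kv (omega P).1 1 (omega P).2
    (- omega (omega P)).1 1 (- omega (omega P)).2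
    = - (1 + w * (kv * P.2 ^+ 3)) / P.1.
  rewrite /rotY /=.
  transitivity (- (1 + (w ^+ 3) ^+ 3 * w * (kv * P.2 ^+ 3)) / P.1).
    by field.
  by rewrite w3 expr1n mul1r.
have eX : rotX kv (omega P).1 1 (omega P).2
    (- omega (omega P)).1 1 (- omega (omega P)).2
    = (1 + w ^+ 2 * (kv * P.2 ^+ 3)) / P.1.
  rewrite /rotX /=.
  transitivity ((1 + (w ^+ 3) ^+ 2 * w ^+ 2 * (kv * P.2 ^+ 3)) / P.1).
    by field.
  by rewrite w3 expr1n mul1r.
have eZ : rotZ (omega P).1 1 (omega P).2
    (- omega (omega P)).1 1 (- omega (omega P)).2
    = - ((w - w ^+ 2) * P.2).
  rewrite /rotZ /=.
  transitivity (- ((w ^+ 3 * w - w ^+ 2) * P.2)).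
    by field.
  by rewrite w3 mul1r.
have n0 : 1 + w * (kv * P.2 ^+ 3) != 0.
  move: Y0; rewrite eY mulf_eq0 oppr_eq0 negb_or; by case/andP.
by split=> //; rewrite /= ?eX eY ?eZ; field; rewrite n0 x0 oppr_eq0 n0.
Qed.

Lemma sqrtm3_sqr P : sqrtm3 (sqrtm3 P) = - (P *+ 3).
Proof.
have e : omega P + omega (omega P) = - P.
  by apply/eqP; rewrite -addr_eq0 addrC addrA omega_sum.
rewrite /sqrtm3 !omegaB !omega3 opprB addrACA [omega (omega P) + _]addrC e.
by rewrite !mulrS mulr0n addr0 !opprD.
Qed.

Lemma three_torsion_subproof : on_chart kv (- w) 0.
Proof.
by rewrite /on_chart expr0n mulr0 exprNn w_cube mulr1 -signr_odd expr1 addNr.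
Qed.

(** The point [-w : 1 : 0]. Having Z = 0, it is fixed by [omega], hence killed by [sqrtm3]. *)
Definition inftors := @Point K k (-w, 0) three_torsion_subproof.

Lemma sqrtm3_inftors : sqrtm3 inftors = 0.
Proof.
have e : omega inftors = inftors by apply: point_eq; rewrite //= mulr0.
by rewrite /sqrtm3 !e subrr.
Qed.

Lemma inftors_multiples (P : point k) :
  P.2 = 0 -> P \in [:: 0; inftors; inftors *+ 2].
Proof.
move=> z0; have e2 : (inftors *+ 2).1 = - w ^+ 2.
  rewrite mulr2n /=; transitivity (- w ^+ 3 / w); last by field; exact: w_neq0.
  by congr (_ / _); rewrite /rotX /rotY /=; ring.
have e2' : (inftors *+ 2).2 = 0 by rewrite mulr2n /= /rotZ /=; ring.
have := pointE P; rewrite z0 expr0n mulr0.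
have -> : P.1 ^+ 3 + 1 = (P.1 + 1) * (P.1 + w) * (P.1 + w ^+ 2).
  transitivity (P.1 ^+ 3 + (w ^+ 2 + w + 1) * (P.1 ^+ 2 + w * P.1) + w ^+ 3);
    last by ring.
  by rewrite w_root w_cube; ring.
move/eqP; rewrite !mulf_eq0 !addr_eq0 -orbA !inE => /or3P[] /eqP e.
- by rewrite (_ : P = 0) ?eqxx //; apply: point_eq.
- by rewrite (_ : P = inftors) ?eqxx ?orbT //; apply: point_eq.
- by rewrite (_ : P = inftors *+ 2) ?eqxx ?orbT //; apply: point_eq; rewrite ?e2 ?e2'.
Qed.

End ComplexMultiplication.
(** * Heights and descent over a rational function field *)

Section Fractions.
Variable R : idomainType.

Lemma fraction_ex (x : {fraction R}) :
  exists2 ab : R * R, ab.2 != 0 & x = tofrac ab.1 / tofrac ab.2.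
Proof.
elim/quotW: x => r; exists (\n_r, \d_r); rewrite ?denom_ratioP //=.
have d0 : tofrac (\d_r) != 0 by rewrite tofrac_eq0 denom_ratioP.
apply: (mulIf d0); rewrite divfK //; unlock FracField.tofrac.
rewrite -[LHS]FracField.pi_mul; apply/eqP; rewrite FracField.equivf_def.
rewrite /FracField.mulf !numden_Ratio ?mulf_neq0 ?oner_neq0 ?denom_ratioP //.
by rewrite !mulr1 mulrC.
Qed.

Variables (K : fieldType) (f : {rmorphism R -> K}).
Hypothesis f_inj : injective f.

Let f_neq0 a : a != 0 -> f a != 0.
Proof. by rewrite -(inj_eq f_inj) rmorph0. Qed.

Lemma fraction_lift :
  exists phi : {rmorphism {fraction R} -> K}, forall a, phi (tofrac a) = f a.
Proof.
pose ab x := sig2_eqW (fraction_ex x).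
pose phi x := f (s2val (ab x)).1 / f (s2val (ab x)).2.
have phiE a b : b != 0 -> phi (tofrac a / tofrac b) = f a / f b.
  move=> b0; rewrite /phi; case: (ab _) => -[n d] /= d0 e.
  apply/eqP; rewrite eqr_div ?f_neq0 // -!rmorphM (inj_eq f_inj).
  by rewrite -tofrac_eq !tofracM -eqr_div ?tofrac_eq0 // e.
have phi1 a : phi (tofrac a) = f a.
  by have := phiE a 1 (oner_neq0 _); rewrite !rmorph1 !divr1.
have phiB : zmod_morphism phi.
  move=> x y; case: (fraction_ex x) => -[a b] /= b0 ->.
  case: (fraction_ex y) => -[c d] /= d0 ->; rewrite -mulNr -tofracN.
  rewrite addf_div ?tofrac_eq0 // -!tofracM -tofracD !phiE ?mulf_neq0 //.
  by rewrite -mulNr addf_div ?f_neq0 // rmorphD !rmorphM rmorphN.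
have phiM : monoid_morphism phi.
  split=> [|x y]; first by rewrite -tofrac1 phi1 rmorph1.
  case: (fraction_ex x) => -[a b] /= b0 ->.
  case: (fraction_ex y) => -[c d] /= d0 ->.
  by rewrite mulf_div -!tofracM !phiE ?mulf_neq0 // mulf_div !rmorphM.
pose phiA := GRing.isZmodMorphism.Build _ _ phi phiB.
pose phiR := GRing.isMonoidMorphism.Build _ _ phi phiM.
pose F : {rmorphism {fraction R} -> K} := HB.pack phi phiA phiR.
by exists F.
Qed.

End Fractions.
Section RationalFunctions.
Variables (L K : fieldType) (iota : {rmorphism {poly L} -> K}).
Hypothesis iota_inj : injective iota.
Hypothesis iota_frac : forall x : K,
  exists2 ab : {poly L} * {poly L}, ab.2 != 0 & x = iota ab.1 / iota ab.2.
Local Notation "p %:F" := (iota p).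

Lemma iota_eq0 p : (iota p == 0) = (p == 0).
Proof. by rewrite -(inj_eq iota_inj) rmorph0. Qed.

Lemma size1_dvdp_sqr_separable (p s : {poly L}) :
  separable_poly p -> s ^+ 2 %| p -> size s = 1%N.
Proof.
by move=> sep_p; apply: contraTeq => s1; rewrite separable_nosquare.
Qed.

Lemma coprime_fraction_ex (x : K) :
  exists2 ab : {poly L} * {poly L}, coprimep ab.1 ab.2 && (ab.2 != 0)
    & x = ab.1%:F / ab.2%:F.
Proof.
case: (iota_frac x) => -[a b] /= b0 ->; pose g := gcdp a b.
have g0 : g != 0 by rewrite gcdp_eq0 negb_and b0 orbT.
have ea : a = a %/ g * g by rewrite divpK ?dvdp_gcdl.
have eb : b = b %/ g * g by rewrite divpK ?dvdp_gcdr.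
have b'0 : b %/ g != 0 by apply: contraNneq b0 => e; rewrite eb e mul0r.
exists (a %/ g, b %/ g) => /=.
  by rewrite b'0 andbT coprimep_div_gcd ?b0 ?orbT.
apply/eqP; rewrite eqr_div ?iota_eq0 // -!rmorphM (inj_eq iota_inj).
by rewrite {1}ea {2}eb mulrAC mulrA.
Qed.

(** From a^3 = p b^3 with a and b coprime, a^2 divides the squarefree p, so a is constant; but p
    divides a^3 and is not constant. *)
Lemma separable_not_cube (p : {poly L}) :
  separable_poly p -> (1 < size p)%N -> forall x : K, x ^+ 3 != p%:F.
Proof.
move=> sep_p sz_p x; case: (coprime_fraction_ex x) => -[a b] /= /andP[co b0] ->.
apply/eqP => e; have {e} : a ^+ 3 = p * b ^+ 3.
  apply/eqP; rewrite -(inj_eq iota_inj) rmorphXn rmorphM rmorphXn -e expr_div_n divfK //.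
  by rewrite expf_neq0 // iota_eq0.
move=> e.
have a1 : size a = 1%N.
  apply: (size1_dvdp_sqr_separable sep_p).
  have : a ^+ 2 %| p * b ^+ 3 by rewrite -e dvdp_exp2l.
  by rewrite Gauss_dvdpl //; apply: coprimep_expl; apply: coprimep_expr.
have a0 : a != 0 by rewrite -size_poly_eq0 a1.
have : (size p <= size (a ^+ 3))%N.
  by rewrite dvdp_leq ?expf_neq0 // e dvdp_mulr.
have : (size (a ^+ 3)).-1 = 0%N by rewrite size_exp a1.
by move: sz_p; lia.
Qed.

(** * Coprime polynomial coordinates, heights and slots *)

Section Heights.
Variables (kp : {poly L}) (k : noncube K).
Hypothesis k_kp : noncube_val k = kp%:F.
Hypothesis sep_kp : separable_poly kp.
Implicit Types P Q : point k.

Definition primitive P (t : {poly L} * {poly L} * {poly L}) :=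
  [&& coprimep t.1.1 t.1.2, t.1.2 != 0,
      P.1 == t.1.1%:F / t.1.2%:F & P.2 == t.2%:F / t.1.2%:F].

(** Reducing the fraction x gives coprime X and Y. If r / s is the resulting Z in lowest terms, the
    curve equation makes s^2 divide k, so s is constant because k is squarefree: Z is a polynomial
    as well. *)
Lemma primitive_ex P : exists t, primitive P t.
Proof.
case: (coprime_fraction_ex P.1) => -[X Y] /= /andP[co Y0] eX.
have Y0F : Y%:F != 0 by rewrite iota_eq0.
case: (coprime_fraction_ex (P.2 * Y%:F)) => -[r s] /= /andP[cors s0] eZ.
have s0F : s%:F != 0 by rewrite iota_eq0.
have e : (X ^+ 3 + Y ^+ 3) * s ^+ 3 = kp * r ^+ 3.
  apply/eqP; rewrite -(inj_eq iota_inj) !rmorphM rmorphD !rmorphXn -k_kp.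
  have eX' : P.1 * Y%:F = X%:F by rewrite eX (divfK Y0F).
  have eZ' : P.2 * Y%:F * s%:F = r%:F by rewrite eZ (divfK s0F).
  rewrite -eX' -eZ'; move: (pointE P).
  move: (Y%:F) (s%:F) (P.1) (P.2) (noncube_val k) => y t x z c e.
  by apply/eqP; transitivity ((x ^+ 3 + 1) * y ^+ 3 * t ^+ 3); [|rewrite e]; ring.
have s1 : size s = 1%N.
  apply: (size1_dvdp_sqr_separable sep_kp).
  have : s ^+ 2 %| kp * r ^+ 3 by rewrite -e dvdp_mull // dvdp_exp2l.
  rewrite Gauss_dvdpl //; apply: coprimep_expl; apply: coprimep_expr.
  by rewrite coprimep_sym.
have /eqP/size_poly1P[c c0 es] := s1.
exists (X, Y, c^-1 *: r); apply/and4P; split=> //=; first by rewrite eX.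
rewrite -[P.2](mulfK Y0F) eZ; apply/eqP; congr (_ / _).
apply: (mulIf s0F); rewrite divfK // -rmorphM; congr _%:F.
by rewrite es -scalerAl mulrC mul_polyC scalerA mulVf // scale1r.
Qed.

Definition numX P := (xchoose (primitive_ex P)).1.1.
Definition numY P := (xchoose (primitive_ex P)).1.2.
Definition numZ P := (xchoose (primitive_ex P)).2.

Lemma num_primitive P : primitive P (numX P, numY P, numZ P).
Proof. exact: (xchooseP (primitive_ex P)). Qed.

Lemma num_coprime P : coprimep (numX P) (numY P).
Proof. by case/and4P: (num_primitive P). Qed.

Lemma numY_neq0 P : numY P != 0.
Proof. by case/and4P: (num_primitive P). Qed.

Lemma num_x P : P.1 = (numX P)%:F / (numY P)%:F.
Proof. by case/and4P: (num_primitive P) => _ _ /eqP. Qed.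

Lemma num_z P : P.2 = (numZ P)%:F / (numY P)%:F.
Proof. by case/and4P: (num_primitive P) => _ _ _ /eqP. Qed.

Lemma numX_neq0 P : numX P != 0.
Proof.
by have := point_neq0 P; rewrite num_x mulf_eq0 negb_or iota_eq0 => /andP[].
Qed.

Lemma num_curve P : numX P ^+ 3 + numY P ^+ 3 = kp * numZ P ^+ 3.
Proof.
have Y0 : (numY P)%:F != 0 by rewrite iota_eq0 numY_neq0.
apply/eqP; rewrite -(inj_eq iota_inj) !rmorphM rmorphD !rmorphXn -k_kp; apply/eqP.
apply: (mulIf (expf_neq0 3 (invr_neq0 Y0))); rewrite exprVn.
have := pointE P; rewrite num_x num_z.
move: (iota (numX P)) (iota (numY P)) (iota (numZ P)) Y0 => x y z y0 e.
transitivity ((x / y) ^+ 3 + 1); first by field.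
by rewrite e; field.
Qed.

(** The degree of Z is left out because the curve equation bounds it by those of X and Y, see
    [sizeZ]. *)
Definition height P := (maxn (size (numX P)) (size (numY P))).-1.

Lemma sizeX P : (size (numX P) <= (height P).+1)%N.
Proof. by rewrite /height; have := numY_neq0 P; rewrite -size_poly_gt0; lia. Qed.

Lemma sizeY P : (size (numY P) <= (height P).+1)%N.
Proof. by rewrite /height; have := numY_neq0 P; rewrite -size_poly_gt0; lia. Qed.

(** Every fraction for x is a common multiple of the reduced one, so heights can be bounded and
    slots computed from unreduced formulas. *)
Lemma num_dvd P A B : B != 0 -> P.1 = A%:F / B%:F ->
  exists2 g, g != 0 & A = numX P * g /\ B = numY P * g.
Proof.
move=> B0; rewrite num_x => /eqP.
rewrite eqr_div ?iota_eq0 ?numY_neq0 // -!rmorphM (inj_eq iota_inj) => /eqP e.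
have /dvdpP[g eB] : numY P %| B.
  have : numY P %| numX P * B by rewrite e dvdp_mull.
  by rewrite Gauss_dvdpr // coprimep_sym num_coprime.
exists g; first by apply: contraNneq B0 => g0; rewrite eB g0 mul0r.
split; last by rewrite eB mulrC.
by apply: (mulIf (numY_neq0 P)); rewrite -e eB mulrA.
Qed.

Lemma height_le P A B n : B != 0 -> P.1 = A%:F / B%:F ->
  (size A <= n.+1)%N -> (size B <= n.+1)%N -> (height P <= n)%N.
Proof.
move=> B0 eP; case: (num_dvd B0 eP) => g g0 [-> ->].
rewrite /height !size_mul ?numX_neq0 ?numY_neq0 //.
move: g0; rewrite -size_poly_gt0.
by move: (size g) (size (numX P)) (size (numY P)) => a b c; lia.
Qed.

Lemma height_coprime P A B : coprimep A B -> B != 0 -> P.1 = A%:F / B%:F ->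
  height P = (maxn (size A) (size B)).-1.
Proof.
move=> co B0 eP; case: (num_dvd B0 eP) co => g g0 [-> ->].
rewrite coprimepMl !coprimepMr coprimepp => /andP[_ /andP[_ /eqP g1]].
rewrite /height !size_mul ?numX_neq0 ?numY_neq0 // g1.
by rewrite !addn1.
Qed.

Lemma sizeZ P : numZ P != 0 ->
  ((size kp).-1 + 3 * (size (numZ P)).-1 <= 3 * height P)%N.
Proof.
move=> Z0; have k0 := separable_poly_neq0 sep_kp.
have : (size (kp * numZ P ^+ 3)%R <= (3 * height P).+1)%N.
  rewrite -num_curve; apply: leq_trans (size_polyD _ _) _.
  rewrite geq_max !(leq_trans (size_poly_exp_leq _ _)) //.
    by have := sizeY P; lia.
  by have := sizeX P; lia.
have Z30 : numZ P ^+ 3 != 0 by rewrite expf_neq0.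
rewrite size_mul //.
have : (size (numZ P ^+ 3)%R).-1 = ((size (numZ P)).-1 * 3)%N by rewrite size_exp.
move: k0 Z30; rewrite -!size_poly_gt0.
move: (size (numZ P ^+ 3)%R) (size (numZ P)) (size kp) (height P) => a b c h.
by lia.
Qed.

Lemma height0 P : (1 < size kp)%N -> height P = 0%N -> P.2 = 0.
Proof.
move=> sz_kp h0; have [z0|/sizeZ] := eqVneq (numZ P) 0; last by rewrite h0; lia.
by rewrite num_z z0 rmorph0 mul0r.
Qed.

Lemma height_opp P : height (- P) = height P.
Proof.
have le Q : (height (- Q) <= height Q)%N.
  apply: (@height_le _ (numY Q) (numX Q)); rewrite ?numX_neq0 ?sizeX ?sizeY //=.
  by rewrite num_x invf_div.
by apply/eqP; rewrite eqn_leq le -{1}[P]opprK le.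
Qed.


Definition sum_numX P Q : {poly L} :=
  numX Q ^+ 2 * numX P * numY P + kp * numZ P ^+ 2 * numZ Q * numY Q.
Definition sum_numY P Q : {poly L} :=
  - kp * numZ Q ^+ 2 * numZ P * numX P - numY P ^+ 2 * numX Q * numY Q.

Lemma num_add P Q : sum_numY P Q != 0 /\
  (P + Q).1 = (sum_numX P Q)%:F / (sum_numY P Q)%:F.
Proof.
have eX : (sum_numX P Q)%:F = rotX (noncube_val k) P.1 1 P.2 Q.1 1 Q.2
                              * ((numY P)%:F * (numY Q)%:F) ^+ 2.
  rewrite /sum_numX /rotX !num_x !num_z k_kp !(rmorphD, rmorphM, rmorphXn).
  move: (numY_neq0 P) (numY_neq0 Q); rewrite -!iota_eq0 => y1 y2.
  by field; rewrite y1 y2.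
have eY : (sum_numY P Q)%:F = rotY (noncube_val k) P.1 1 P.2 Q.1 1 Q.2
                              * ((numY P)%:F * (numY Q)%:F) ^+ 2.
  rewrite /sum_numY /rotY !num_x !num_z k_kp !(rmorphB, rmorphN, rmorphM, rmorphXn).
  move: (numY_neq0 P) (numY_neq0 Q); rewrite -!iota_eq0 => y1 y2.
  by field; rewrite y1 y2.
have n0 : ((numY P)%:F * (numY Q)%:F) ^+ 2 != 0.
  by rewrite expf_neq0 // mulf_neq0 // iota_eq0 numY_neq0.
split; first by rewrite -iota_eq0 eY mulf_neq0 // rotY_neq0.
have r0 := rotY_neq0 P Q; rewrite eX eY /=.
move: r0 n0; move: (rotX _ _ _ _ _ _ _) (rotY _ _ _ _ _ _ _) (_ ^+ 2).
by move=> a b c b0 c0; field; rewrite b0 c0.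
Qed.

Lemma size_mulS (R : nzRingType) (p q : {poly R}) a b :
  (size p <= a.+1)%N -> (size q <= b.+1)%N -> (size (p * q)%R <= (a + b).+1)%N.
Proof.
move=> pa qb; apply: leq_trans (size_polyMleq _ _) _.
by move: (size p) (size q) pa qb => m n; lia.
Qed.

Lemma size_expS (R : nzRingType) (p : {poly R}) a n :
  (size p <= a.+1)%N -> (size (p ^+ n)%R <= (n * a).+1)%N.
Proof.
move=> pa; elim: n => [|n IHn]; first by rewrite size_poly1.
by rewrite exprS mulSn size_mulS.
Qed.

(** Two thirds of the bound [sizeZ] for P plus one third of that for Q: the degree of k is then
    counted exactly once. *)
Lemma size_kZ P Q :
  (size (kp * numZ P ^+ 2 * numZ Q)%R <= (2 * height P + height Q).+1)%N.
Proof.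
have [->|/sizeZ] := eqVneq (numZ P) 0; first by rewrite expr0n mulr0 mul0r size_poly0.
have [->|/sizeZ] := eqVneq (numZ Q) 0; first by rewrite mulr0 size_poly0.
move=> zQ zP; have le (p : {poly L}) : (size p <= (size p).-1.+1)%N by case: size.
apply: leq_trans
  (size_mulS (size_mulS (le kp) (size_expS 2 (le (numZ P)))) (le (numZ Q))) _.
move: (size kp) (size (numZ P)) (size (numZ Q)) zP zQ => a b c; lia.
Qed.

Lemma height_add P Q : (height (P + Q)%R <= 2 * height P + 2 * height Q)%N.
Proof.
have [Y0 eX] := num_add P Q; apply: (height_le Y0 eX).
  apply: leq_trans (size_polyD _ _) _; rewrite geq_max; apply/andP; split.
    apply: leq_trans
      (size_mulS (size_mulS (size_expS 2 (sizeX Q)) (sizeX P)) (sizeY P)) _.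
    by lia.
  by apply: leq_trans (size_mulS (size_kZ P Q) (sizeY Q)) _; lia.
apply: leq_trans (size_polyD _ _) _.
rewrite geq_max !size_polyN; apply/andP; split.
  rewrite !mulNr size_polyN.
  by apply: leq_trans (size_mulS (size_kZ Q P) (sizeX P)) _; lia.
apply: leq_trans
  (size_mulS (size_mulS (size_expS 2 (sizeY P)) (sizeX Q)) (sizeY Q)) _.
by lia.
Qed.

Section Specialization.
Variable t : L.
Hypothesis kt : kp.[t] = 0.

Lemma num_curve_at P : (numX P).[t] ^+ 3 + (numY P).[t] ^+ 3 = 0.
Proof.
have := congr1 (horner^~ t) (num_curve P).
by rewrite /= !(horner_exp, hornerD, hornerN, hornerM) kt mul0r.
Qed.

Lemma numY_at P : (numY P).[t] != 0.
Proof.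
apply/eqP => Y0; have := num_curve_at P.
rewrite Y0 expr0n addr0 => /eqP; rewrite expf_eq0 /= => rX.
by have := coprimep_root (num_coprime P) rX; rewrite Y0 eqxx.
Qed.

Lemma numX_at P : (numX P).[t] != 0.
Proof.
apply/eqP => X0; have := num_curve_at P.
rewrite X0 expr0n add0r => /eqP; rewrite expf_eq0 /=; exact/negP/numY_at.
Qed.

(* The fibre at a root t of k is three lines through [0 : 0 : 1]; the slot
   is the cube of unity telling which line P meets. *)
Definition slot P := - (numX P).[t] / (numY P).[t].

Lemma slot_fraction P A B :
  P.1 = A%:F / B%:F -> B.[t] != 0 -> slot P = - A.[t] / B.[t].
Proof.
move=> eP Bt; have B0 : B != 0.
  by apply: contraNneq Bt => ->; rewrite horner0.
case: (num_dvd B0 eP) Bt => g g0 [-> ->]; rewrite !hornerM /slot.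
rewrite mulf_eq0 negb_or => /andP[Y0 gt0].
by field; rewrite Y0 gt0.
Qed.

(** At a root of k every term containing k drops out of the rotated law, and the quotient that
    remains is the product of the two slots. *)
Lemma slot_add P Q : slot (P + Q) = slot P * slot Q.
Proof.
have [Y0 e] := num_add P Q; have yP := numY_at P; have yQ := numY_at Q.
have xP := numX_at P; have xQ := numX_at Q.
have eY : (sum_numY P Q).[t] = - ((numY P).[t] ^+ 2 * (numX Q).[t] * (numY Q).[t]).
  by rewrite /sum_numY !(horner_exp, hornerD, hornerN, hornerM) kt; ring.
have eX : (sum_numX P Q).[t] = (numX Q).[t] ^+ 2 * (numX P).[t] * (numY P).[t].
  by rewrite /sum_numX !(horner_exp, hornerD, hornerN, hornerM) kt; ring.
have n0 : (sum_numY P Q).[t] != 0.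
  by rewrite eY oppr_eq0 !mulf_neq0 // expf_neq0.
rewrite (slot_fraction e n0) /slot eX eY.
by field; rewrite yP yQ -eY n0.
Qed.

Lemma slot_cube P : slot P ^+ 3 = 1.
Proof.
have Y0 := numY_at P; have e := num_curve_at P.
have eX : (numX P).[t] ^+ 3 = - (numY P).[t] ^+ 3 by apply/eqP; rewrite -addr_eq0 e.
by rewrite /slot expr_div_n exprNn -signr_odd /= eX; field.
Qed.

Lemma slot_neq0 P : slot P != 0.
Proof.
by apply: contraTneq (oner_neq0 L) => e; rewrite -(slot_cube P) e expr0n eqxx.
Qed.

Lemma slot0 : slot 0 = 1.
Proof.
by apply: (mulfI (slot_neq0 0)); rewrite -slot_add addr0 mulr1.
Qed.

Lemma slot_opp P : slot (- P) = (slot P)^-1.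
Proof.
by apply: (mulfI (slot_neq0 P)); rewrite -slot_add subrr slot0 mulfV ?slot_neq0.
Qed.

End Specialization.

(** Up to a constant, the cube root of u is g = gcd(u, z). As g is coprime to v, g^3 divides u.
    Conversely u divides u^3 and z^3, which are g^3 times the coprime cubes of u / g and z / g, so u
    divides g^3. *)
Lemma coprime_cube (u v z : {poly L}) c : coprimep u v -> c != 0 -> z != 0 ->
  u * v = c *: z ^+ 3 -> exists2 g, g != 0 & exists A, u = g *: A ^+ 3.
Proof.
move=> co c0 z0 e; have u0 : u != 0.
  apply: contraNneq z0 => u0; move/eqP: e.
  by rewrite u0 mul0r eq_sym scaler_eq0 (negPf c0) expf_eq0.
pose g := gcdp u z.
suff /eqpf_eq[a a0 ->] : u %= g ^+ 3 by exists a => //; exists g.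
apply/andP; split; last first.
  have : g ^+ 3 %| u * v by rewrite e dvdpZr // dvdp_exp2r // dvdp_gcdr.
  rewrite Gauss_dvdpl // coprimep_expl //.
  by apply: coprimep_dvdr co; rewrite dvdp_gcdl.
have eu : u = u %/ g * g by rewrite divpK ?dvdp_gcdl.
have ez : z = z %/ g * g by rewrite divpK ?dvdp_gcdr.
have co' : coprimep ((u %/ g) ^+ 3) ((z %/ g) ^+ 3).
  by apply: coprimep_expl; apply: coprimep_expr; rewrite coprimep_div_gcd ?u0.
have d1 : u %| g ^+ 3 * (u %/ g) ^+ 3.
  by rewrite -exprMn mulrC -eu dvdp_exp.
have d2 : u %| g ^+ 3 * (z %/ g) ^+ 3.
  by rewrite -exprMn mulrC -ez -(dvdpZr _ _ c0) -e dvdp_mulr.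
have : u %| gcdp (g ^+ 3 * (u %/ g) ^+ 3) (g ^+ 3 * (z %/ g) ^+ 3).
  by rewrite dvdp_gcd d1.
rewrite (eqp_dvdr _ (gcdp_mul2l _ _ _)) => /dvdp_trans; apply.
have /eqpf_eq[a a0 ->] : gcdp ((u %/ g) ^+ 3) ((z %/ g) ^+ 3) %= 1.
  by rewrite gcdp_eqp1.
by rewrite -scalerAr dvdpZl // mulr1.
Qed.

Section Eisenstein.
Variable w : L.
Hypotheses (w_root : w ^+ 2 + w + 1 = 0) (w1 : w != 1).

Local Notation W := w%:P.

Let W_root : W ^+ 2 + W + 1 = 0.
Proof. by rewrite -polyC_exp -!polyCD w_root. Qed.

Let W_cube : W ^+ 3 = 1.
Proof. by rewrite -polyC_exp w_cube. Qed.

Lemma iota_w_root : W%:F ^+ 2 + W%:F + 1 = 0.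
Proof. by rewrite -rmorphXn -rmorphD -(rmorph1 iota) -rmorphD W_root rmorph0. Qed.

Local Notation sqrtm3 := (sqrtm3 iota_w_root).

(* Up to an invertible linear substitution, sqrtm3 maps (X, Y) to (X^3, Y^3),
   which are again coprime. *)
Lemma height_sqrtm3 P : height (sqrtm3 P) = (3 * height P)%N.
Proof.
set X := numX P; set Y := numY P.
pose A := W * Y ^+ 3 - W ^+ 2 * X ^+ 3; pose B := W * X ^+ 3 - W ^+ 2 * Y ^+ 3.
have eX : (W - 1) * X ^+ 3 = W * A + B.
  by transitivity ((W - W ^+ 3) * X ^+ 3); [rewrite W_cube | rewrite /A /B; ring].
have eY : (W - 1) * Y ^+ 3 = A + W * B.
  by transitivity ((W - W ^+ 3) * Y ^+ 3); [rewrite W_cube | rewrite /A /B; ring].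
have w10 : w - 1 != 0 by rewrite subr_eq0.
have dvdW d p : d %| (W - 1) * p -> d %| p.
  by rewrite -polyCB mul_polyC dvdpZr.
have coAB : coprimep A B.
  apply/coprimepP => d dA dB.
  have dX : d %| X ^+ 3 by apply: dvdW; rewrite eX dvdp_add // dvdp_mull.
  have dY : d %| Y ^+ 3 by apply: dvdW; rewrite eY dvdp_add // dvdp_mull.
  have : coprimep (X ^+ 3) (Y ^+ 3).
    by apply: coprimep_expl; apply: coprimep_expr; apply: num_coprime.
  by move/coprimepP; apply.
have [n0 ex _] := sqrtm3_coord iota_w_root P.
have Y0 : Y%:F != 0 by rewrite iota_eq0 numY_neq0.
have ek : noncube_val k * P.2 ^+ 3 = (X%:F ^+ 3 + Y%:F ^+ 3) / Y%:F ^+ 3.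
  by rewrite -pointE num_x -/X -/Y; field.
have W2 : 1 + W%:F = - W%:F ^+ 2.
  by apply/eqP; rewrite -addr_eq0 -iota_w_root; apply/eqP; ring.
have W22 : 1 + W%:F ^+ 2 = - W%:F.
  by apply/eqP; rewrite -addr_eq0 -iota_w_root; apply/eqP; ring.
have eB : 1 + W%:F * (noncube_val k * P.2 ^+ 3) = B%:F / Y%:F ^+ 3.
  transitivity ((W%:F * X%:F ^+ 3 + (1 + W%:F) * Y%:F ^+ 3) / Y%:F ^+ 3).
    by rewrite ek; field.
  by rewrite W2 /B !(rmorphB, rmorphM, rmorphXn) mulNr.
have eA : 1 + W%:F ^+ 2 * (noncube_val k * P.2 ^+ 3) = - A%:F / Y%:F ^+ 3.
  transitivity ((W%:F ^+ 2 * X%:F ^+ 3 + (1 + W%:F ^+ 2) * Y%:F ^+ 3) / Y%:F ^+ 3).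
    by rewrite ek; field.
  by rewrite W22 /A !(rmorphB, rmorphM, rmorphXn); congr (_ / _); ring.
have B0F : B%:F != 0.
  by move: n0; rewrite eB mulf_eq0 negb_or => /andP[].
have B0 : B != 0 by rewrite -iota_eq0.
have exAB : (sqrtm3 P).1 = A%:F / B%:F.
  by rewrite ex eA eB; field; rewrite Y0 B0F.
rewrite (height_coprime coAB B0 exAB).
have sW : (size W <= 1)%N := size_polyC_leq1 w.
have sX : (size (X ^+ 3)).-1 = ((size X).-1 * 3)%N by rewrite size_exp.
have sY : (size (Y ^+ 3)).-1 = ((size Y).-1 * 3)%N by rewrite size_exp.
have size3 (p q : {poly L}) : (size (W * p ^+ 3 - W ^+ 2 * q ^+ 3)%R
    <= maxn (size (p ^+ 3)%R) (size (q ^+ 3)%R))%N.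
  rewrite -polyC_exp !mul_polyC; apply: leq_trans (size_polyD _ _) _.
  by rewrite size_polyN geq_max !leq_max !size_scale_leq orbT.
have sizeX3 : (size (X ^+ 3)%R <= maxn (size A) (size B))%N.
  rewrite -(size_scale _ w10) -mul_polyC polyCB eX.
  apply: leq_trans (size_polyD _ _) _.
  by rewrite geq_max !leq_max leqnn orbT mul_polyC size_scale_leq.
have sizeY3 : (size (Y ^+ 3)%R <= maxn (size A) (size B))%N.
  rewrite -(size_scale _ w10) -mul_polyC polyCB eY.
  apply: leq_trans (size_polyD _ _) _.
  by rewrite geq_max !leq_max leqnn mul_polyC size_scale_leq orbT.
have := size3 Y X; have := size3 X Y; rewrite -/A -/B /height -/X -/Y.
move: sX sY sizeX3 sizeY3.
move: (size (X ^+ 3)) (size (Y ^+ 3)) (size A) (size B) (size X) (size Y).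
by move=> a b c d e f; lia.
Qed.

Lemma slot_inftors t : kp.[t] = 0 -> slot t (inftors k iota_w_root) = w.
Proof.
move=> kt; rewrite (@slot_fraction t _ (- W) 1) ?hornerE ?oner_neq0 //=.
  by rewrite opprK divr1.
by rewrite rmorph1 divr1 rmorphN.
Qed.

End Eisenstein.

(** * Descent through sqrt(-3) *)

Section Descent.
Variables (w : L) (c : L) (ts : seq L).
Hypotheses (w_root : w ^+ 2 + w + 1 = 0) (w1 : w != 1).
Hypotheses (kp_split : kp = c *: \prod_(t <- ts) ('X - t%:P)) (uniq_ts : uniq ts).
Local Notation W := w%:P.
Local Notation sqrtm3 := (sqrtm3 (iota_w_root w_root)).

Let c0 : c != 0.
Proof.
apply: contraTneq sep_kp => c0; rewrite kp_split c0 scale0r.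
by apply/negP => /separable_poly_neq0; rewrite eqxx.
Qed.

Lemma kp_root t : t \in ts -> kp.[t] = 0.
Proof.
move=> t_ts; rewrite kp_split hornerZ horner_prod.
by rewrite (big_rem t) //= hornerXsubC subrr mul0r mulr0.
Qed.

(** The linear factors of X^3 + Y^3, scaled by powers of w so that their sum is 0; the product is
    unchanged because w^3 = 1. *)
Definition factor P j := W ^+ j * (numX P + W ^+ j * numY P).

Definition factor_roots P j := \prod_(t <- ts | slot t P == w ^+ j) ('X - t%:P).

Let w3 : w ^+ 3 = 1. Proof. exact: w_cube. Qed.
Let W3 : W ^+ 3 = 1. Proof. by rewrite -polyC_exp w3. Qed.
Let W_root : W ^+ 2 + W + 1 = 0.
Proof. by rewrite -polyC_exp -!polyCD w_root. Qed.

Lemma factor_sum P : factor P 0 + factor P 1 + factor P 2 = 0.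
Proof.
transitivity ((W ^+ 2 + W + 1) * numX P + (W ^+ 3 * W + W ^+ 2 + 1) * numY P).
  by rewrite /factor; ring.
by rewrite W3 mul1r [W + _]addrC W_root !mul0r addr0.
Qed.

Lemma factor_prod P : factor P 0 * factor P 1 * factor P 2 = kp * numZ P ^+ 3.
Proof.
rewrite -num_curve.
transitivity (W ^+ 3 * (numX P ^+ 3 + W ^+ 3 * numY P ^+ 3
  + (W ^+ 2 + W + 1) * (numX P ^+ 2 * numY P + W * (numX P * numY P ^+ 2)))).
  by rewrite /factor; ring.
by rewrite W3 W_root mul0r addr0 !mul1r.
Qed.

Lemma factor_at P t j : t \in ts ->
  ((factor P j).[t] == 0) = (slot t P == w ^+ j).
Proof.
move=> /kp_root kt; have Y0 := numY_at kt P.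
have w0 := w_neq0 w_root.
rewrite /factor !(horner_exp, hornerM, hornerD, hornerC) mulf_eq0.
rewrite expf_eq0 (negPf w0) andbF /= /slot.
rewrite (can2_eq (divfK Y0) (mulfK Y0)) eqr_oppLR addr_eq0.
by rewrite -mulNr.
Qed.

Let w_exp_inj i j : (i < 3)%N -> (j < 3)%N -> w ^+ i = w ^+ j -> i = j.
Proof.
have w0 := w_neq0 w_root.
have w21 : w ^+ 2 != 1.
  apply: contraNneq w1 => e; rewrite -w3 exprS e mulr1 //.
have w2w : w ^+ 2 != w.
  by apply: contraNneq w1 => e; rewrite -(inj_eq (mulfI w0)) mulr1 -expr2 e.
case: i j => [|[|[|//]]] [|[|[|//]]] // _ _ /eqP; rewrite ?expr0 ?expr1;
  rewrite ?(eq_sym 1) ?(eq_sym w (w ^+ 2)) ?(negPf w1) ?(negPf w21) ?(negPf w2w) //.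
Qed.

Lemma slot_index P t : t \in ts -> exists2 j, (j < 3)%N & slot t P = w ^+ j.
Proof.
move=> /kp_root kt; have := slot_cube kt P; set s := slot t P => s3.
have : (s - 1) * (s - w) * (s - w ^+ 2) = 0.
  transitivity (s ^+ 3 - w ^+ 3 - (w ^+ 2 + w + 1) * (s ^+ 2 - w * s)).
    by ring.
  by rewrite w_root s3 w3 mul0r !subrr.
move/eqP; rewrite !mulf_eq0 !subr_eq0 -orbA => /or3P[] /eqP ->.
- by exists 0%N.
- by exists 1%N.
- by exists 2%N.
Qed.

Lemma factor_coprime P i j : (i < 3)%N -> (j < 3)%N -> i != j ->
  coprimep (factor P i) (factor P j).
Proof.
move=> i3 j3 nij; have w0 := w_neq0 w_root.
have wi m : w ^+ m != 0 by rewrite expf_neq0.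
have nw : w ^+ i - w ^+ j != 0.
  by rewrite subr_eq0; apply: contraNneq nij => /w_exp_inj ->.
rewrite /factor -!polyC_exp !mul_polyC coprimepZl // coprimepZr //.
set X := numX P; set Y := numY P.
apply/coprimepP => d di dj; have /coprimepP := num_coprime P; apply.
  rewrite -/X -(dvdpZr _ _ nw).
  have -> : (w ^+ i - w ^+ j) *: X
      = w ^+ i *: (X + w ^+ j *: Y) - w ^+ j *: (X + w ^+ i *: Y).
    rewrite !scalerDr !scalerA scalerBl opprD addrACA [w ^+ j * _]mulrC.
    by rewrite subrr addr0.
  by rewrite dvdp_sub // dvdpZr.
rewrite -/Y -(dvdpZr _ _ nw).
have -> : (w ^+ i - w ^+ j) *: Y = (X + w ^+ i *: Y) - (X + w ^+ j *: Y).
  by rewrite scalerBl opprD addrACA subrr add0r.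
by rewrite dvdp_sub.
Qed.

Let w_exp_eq i j : (i < 3)%N -> (j < 3)%N -> (w ^+ i == w ^+ j) = (i == j).
Proof. by move=> i3 j3; apply/eqP/eqP => [/w_exp_inj -> | ->]. Qed.

Lemma factor_roots_prod P :
  factor_roots P 0 * factor_roots P 1 * factor_roots P 2
    = \prod_(t <- ts) ('X - t%:P).
Proof.
rewrite /factor_roots !(big_mkcond (fun t => slot t P == _)) -!big_split /=.
apply: eq_big_seq => t /(slot_index P) [j j3 ->].
by rewrite !w_exp_eq //; case: j j3 => [|[|[|//]]] _ /=; rewrite ?mulr1 ?mul1r.
Qed.

Lemma factor_roots_neq0 P j : factor_roots P j != 0.
Proof.
by rewrite /factor_roots prodf_seq_neq0; apply/allP => t _;
  rewrite polyXsubC_eq0 implybT.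
Qed.

Lemma factor_roots_dvd P j : factor_roots P j %| factor P j.
Proof.
rewrite /factor_roots -big_filter uniq_roots_dvdp ?uniq_rootsE ?filter_uniq //.
apply/allP => t; rewrite mem_filter => /andP[st t_ts].
by rewrite /root factor_at.
Qed.

(** Dividing each factor by the linear factors of k that it carries leaves three pairwise coprime
    polynomials of product c Z^3, so each of them is a cube up to a constant. *)
Lemma factor_cube P j : numZ P != 0 -> (j < 3)%N ->
  exists2 g, g != 0 & exists A, factor P j = g *: (factor_roots P j * A ^+ 3).
Proof.
move=> Z0 j3; pose q i := factor P i %/ factor_roots P i.
have eq i : factor P i = q i * factor_roots P i.
  by rewrite /q divpK // factor_roots_dvd.
have q_dvd i : q i %| factor P i by rewrite [X in _ %| X]eq dvdp_mulr.
have coq i i' : (i < 3)%N -> (i' < 3)%N -> i != i' -> coprimep (q i) (q i').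
  move=> i3 i'3 n; apply: coprimep_dvdr (q_dvd i) _.
  by apply: coprimep_dvdl (q_dvd i') _; apply: factor_coprime.
have q_prod : q 0 * q 1 * q 2 = c *: numZ P ^+ 3.
  have FR : \prod_(t <- ts) ('X - t%:P) != 0.
    by rewrite -(factor_roots_prod P) !mulf_neq0 ?factor_roots_neq0.
  apply: (mulIf FR); rewrite -{1}(factor_roots_prod P).
  transitivity (factor P 0 * factor P 1 * factor P 2).
    by rewrite !eq; ring.
  by rewrite factor_prod kp_split -!scalerAl mulrC.
have [v [cov ev]] : exists v, coprimep (q j) v /\ q j * v = c *: numZ P ^+ 3.
  case: j j3 => [|[|[|//]]] _.
  - by exists (q 1 * q 2); rewrite mulrA coprimepMr !coq.
  - exists (q 0 * q 2); rewrite coprimepMr !coq //; split=> //.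
    by rewrite -q_prod; ring.
  - exists (q 0 * q 1); rewrite coprimepMr !coq //; split=> //.
    by rewrite -q_prod; ring.
have [g g0 [A eA]] := coprime_cube cov c0 Z0 ev.
by exists g => //; exists A; rewrite eq eA -scalerAl mulrC.
Qed.

(** * Constraints on slots from a character trivial on cubes *)

Section Selmer.
Variable chi : L -> nat.
Hypothesis chiM : forall x y, x != 0 -> y != 0 ->
  chi (x * y) = (chi x + chi y)%N %[mod 3].

Lemma chi_cube x : x != 0 -> chi (x ^+ 3) = 0%N %[mod 3].
Proof.
move=> x0; rewrite exprS chiM ?expf_neq0 // expr2 -modnDmr chiM // modnDmr.
by lia.
Qed.

Lemma chi_opp x : x != 0 -> chi (- x) = chi x %[mod 3].
Proof.
move=> x0; have n0 : -1 != 0 :> L by rewrite oppr_eq0 oner_eq0.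
have chiN1 : chi (-1) = 0%N %[mod 3].
  by have := chi_cube n0; rewrite -signr_odd expr1.
by rewrite -mulN1r chiM // -modnDml chiN1.
Qed.

Lemma chi_prod (I : eqType) (r : seq I) (Q : pred I) F :
  (forall i, i \in r -> Q i -> F i != 0) ->
  chi (\prod_(i <- r | Q i) F i) = (\sum_(i <- r | Q i) chi (F i))%N %[mod 3].
Proof.
have chi1 : chi 1 = 0%N %[mod 3].
  by have := chi_cube (oner_neq0 L); rewrite expr1n.
elim: r => [|i r IHr] F0; first by rewrite !big_nil.
rewrite !big_cons; case: ifP => Qi; last first.
  by apply: IHr => i' r_i'; apply: F0; rewrite inE r_i' orbT.
have Fi0 : F i != 0 by rewrite F0 // mem_head.
have Fr0 i' : i' \in r -> Q i' -> F i' != 0.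
  by move=> r_i'; apply: F0; rewrite inE r_i' orbT.
have P0 : \prod_(i <- r | Q i) F i != 0.
  rewrite prodf_seq_neq0; apply/allP => i' r_i'; apply/implyP; exact: Fr0.
by rewrite chiM // -modnDmr IHr // modnDmr.
Qed.

(** Modulo 3, this is [chi] of the value at t of [factor_roots P j], for t not among its roots. *)
Definition root_weight P j t :=
  (\sum_(t' <- ts | slot t' P == w ^+ j) chi (t - t'))%N.

(* At a root t of slot j, [factor P j] vanishes, so the two other factors are
   opposite there; both are known up to cubes, which [chi] does not see. *)
Lemma selmer_condition P : numZ P != 0 -> exists g : nat -> nat,
  (g 0 + g 1 + g 2 = chi c %[mod 3])%N /\
  forall t j, t \in ts -> (j < 3)%N -> slot t P = w ^+ j ->
    (g (j.+1 %% 3) + root_weight P (j.+1 %% 3) t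
      = g (j.+2 %% 3) + root_weight P (j.+2 %% 3) t %[mod 3])%N.
Proof.
move=> Z0.
have H j : exists g, exists A : {poly L}, (j < 3)%N ->
    g != 0 /\ factor P j = g *: (factor_roots P j * A ^+ 3).
  have [j3|_] := ltnP j 3; last by exists 0; exists 0.
  by have [g g0 [A eA]] := factor_cube Z0 j3; exists g; exists A.
have [[g0 [A0 /(_ isT) [n0 e0]]] [g1 [A1 /(_ isT) [n1 e1]]]
      [g2 [A2 /(_ isT) [n2 e2]]]] := And3 (H 0%N) (H 1%N) (H 2%N).
pose g j := nth 0 [:: g0; g1; g2] j; pose A j := nth 0 [:: A0; A1; A2] j.
have gn0 j : (j < 3)%N -> g j != 0 by case: j => [|[|[|]]].
have eg j : (j < 3)%N -> factor P j = g j *: (factor_roots P j * A j ^+ 3).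
  by case: j => [|[|[|]]].
exists (chi \o g); split.
  have eq : g0 *: (factor_roots P 0 * A0 ^+ 3)
      * (g1 *: (factor_roots P 1 * A1 ^+ 3))
      * (g2 *: (factor_roots P 2 * A2 ^+ 3)) = kp * numZ P ^+ 3.
    by rewrite -e0 -e1 -e2 factor_prod.
  have FR : \prod_(t <- ts) ('X - t%:P) != 0.
    by rewrite -(factor_roots_prod P) !mulf_neq0 ?factor_roots_neq0.
  have {}eq : (g0 * g1 * g2) *: (A0 * A1 * A2) ^+ 3 = c *: numZ P ^+ 3.
    apply: (mulIf FR); transitivity (kp * numZ P ^+ 3).
      by rewrite -eq -(factor_roots_prod P) -!mul_polyC !polyCM; ring.
    by rewrite kp_split -!scalerAl mulrC.
  (* Comparing leading coefficients turns the identity of cubes into g0 g1 g2 a^3 = c z^3 in L, to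
     which [chi] applies. *)
  pose a := lead_coef (A0 * A1 * A2); pose z := lead_coef (numZ P).
  have z0 : z != 0 by rewrite lead_coef_eq0.
  have el : g0 * g1 * g2 * a ^+ 3 = c * z ^+ 3.
    by have := congr1 lead_coef eq; rewrite !lead_coefZ !lead_coef_exp.
  have a0 : a != 0.
    apply: contraNneq z0 => a0; move/eqP: el.
    by rewrite a0 expr0n mulr0 eq_sym mulf_eq0 (negPf c0) expf_eq0.
  have cube0 x y : x != 0 -> y != 0 -> chi (x * y ^+ 3) = chi x %[mod 3].
    by move=> x0 y0; rewrite chiM ?expf_neq0 // -modnDmr chi_cube // addn0.
  rewrite /=; apply: esym; rewrite -(cube0 c z) // -el cube0 ?mulf_neq0 //.
  rewrite chiM ?mulf_neq0 //.
  by rewrite -modnDml chiM // modnDml.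
move=> t j t_ts j3 st.
pose u := (j.+1 %% 3)%N; pose v := (j.+2 %% 3)%N; rewrite -/u -/v.
have u3 : (u < 3)%N by rewrite ltn_mod.
have v3 : (v < 3)%N by rewrite ltn_mod.
have sum0 : (factor P u).[t] + (factor P v).[t] = 0.
  have : (factor P j).[t] = 0 by apply/eqP; rewrite factor_at // st.
  have := congr1 (horner^~ t) (factor_sum P); rewrite /= !hornerD horner0.
  rewrite /u /v; case: j j3 {st u v u3 v3} => [|[|[|//]]] _ /= => + e; rewrite e.
  - by rewrite add0r.
  - by rewrite addr0 addrC.
  - by rewrite addr0.
have val i : (i < 3)%N -> i != j -> exists a, [/\ a != 0,
    (factor P i).[t] != 0,
    \prod_(t' <- ts | slot t' P == w ^+ i) (t - t') != 0 &
    (factor P i).[t]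
      = g i * (\prod_(t' <- ts | slot t' P == w ^+ i) (t - t') * a ^+ 3)].
  move=> i3 ni; exists (A i).[t].
  have n : (factor P i).[t] != 0.
    by rewrite factor_at // st w_exp_eq // eq_sym.
  have e : (factor P i).[t]
      = g i * (\prod_(t' <- ts | slot t' P == w ^+ i) (t - t') * (A i).[t] ^+ 3).
    rewrite eg // hornerZ hornerM horner_exp /factor_roots horner_prod.
    by under eq_bigr do rewrite hornerXsubC.
  move: (n); rewrite {1}e mulf_eq0 negb_or => /andP[_].
  rewrite mulf_eq0 negb_or expf_eq0 /= => /andP[np na].
  by split.
have [|a [a0 nu nP eu]] := val u u3.
  by rewrite /u; case: j j3 {st u v u3 v3 sum0 val} => [|[|[|]]].
have [|b [b0 nv nQ ev]] := val v v3.
  by rewrite /v; case: j j3 {st u v u3 v3 sum0 val a a0 nu nP eu} => [|[|[|]]].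
move: sum0; rewrite eu ev => /eqP; rewrite addr_eq0 => /eqP e.
have hp i x y : \prod_(t' <- ts | slot t' P == w ^+ i) (t - t') != 0 ->
    x != 0 -> y != 0 ->
    chi (x * (\prod_(t' <- ts | slot t' P == w ^+ i) (t - t') * y ^+ 3))
      = (chi x + root_weight P i t)%N %[mod 3].
  move=> n x0 y0; rewrite chiM ?mulf_neq0 ?expf_neq0 //.
  rewrite -modnDmr chiM ?expf_neq0 //.
  rewrite -[in LHS](modnDmr _ (chi (y ^+ 3))) chi_cube // addn0 chi_prod ?modnDmr //.
  move=> t' t'_ts st'.
  by move: n; rewrite prodf_seq_neq0 => /allP/(_ t' t'_ts)/implyP; apply.
rewrite /= -(hp u (g u) a) ?gn0 // -(hp v (g v) b) ?gn0 // e.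
by rewrite chi_opp // !mulf_neq0 ?gn0 ?expf_neq0.
Qed.

End Selmer.

(** When all slots are 1, factors 1 and 2 carry no root of k and are constants times cubes. Once the
    constants are made equal, they are g V^3 and g U^3. The three factors sum to 0 and have product
    k Z^3, so U^3 + V^3 = k (-Z / (g U V))^3, and this point of the curve is the preimage. *)
Lemma descent_kernel_finite P t0 : t0 \in ts -> numZ P != 0 ->
  (forall t, t \in ts -> slot t P = 1) -> exists Q, P = sqrtm3 Q.
Proof.
move=> t0_ts Z0 sP.
have roots1 j : (0 < j < 3)%N -> factor_roots P j = 1.
  move=> /andP[j0 j3]; rewrite /factor_roots big1_seq // => t /andP[/eqP st /sP].
  by rewrite st => /eqP; rewrite -(expr0 w) w_exp_eq // gtn_eqF.
have cube j : (0 < j < 3)%N -> exists2 g, g != 0 &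
    exists A, factor P j = g *: A ^+ 3 /\ A.[t0] != 0.
  move=> /[dup] /roots1 r1 /andP[j0 j3].
  have [g g0 [A]] := factor_cube Z0 j3; rewrite r1 mul1r => eA.
  exists g => //; exists A; split=> //; apply/negP => /eqP A0.
  have : (factor P j).[t0] == 0.
    by rewrite eA hornerZ horner_exp A0 expr0n mulr0.
  by rewrite factor_at // sP // -(expr0 w) w_exp_eq // ltn_eqF.
have [g1 g10 [A1 [eA1 a10]]] := cube 1%N isT.
have [g2 g20 [A2 [eA2 a20]]] := cube 2%N isT.
(* Factor 0 vanishes at t0, so factors 1 and 2 are opposite there; this makes g1 / g2 an exact cube
   in L. *)
pose r := - A2.[t0] / A1.[t0].
have r0 : r != 0 by rewrite mulf_neq0 ?oppr_eq0 ?invr_eq0.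
have eg : g1 = g2 * r ^+ 3.
  have e0 : (factor P 0).[t0] = 0 by apply/eqP; rewrite factor_at // sP.
  have := congr1 (horner^~ t0) (factor_sum P).
  rewrite /= !hornerD e0 add0r eA1 eA2 !hornerZ !horner_exp horner0 => e.
  have -> : g2 * r ^+ 3 = - (g2 * A2.[t0] ^+ 3) / A1.[t0] ^+ 3.
    by rewrite /r; field.
  move/eqP: e; rewrite addrC addr_eq0 => /eqP ->.
  by rewrite opprK mulfK ?expf_neq0.
pose V := (r *: A1)%:F; pose U := A2%:F; pose g := g2%:P%:F.
pose x := (numX P)%:F; pose y := (numY P)%:F; pose z := (numZ P)%:F.
pose u := W%:F.
have Nz0 (p : {poly L}) : p.[t0] != 0 -> p%:F != 0.
  by rewrite iota_eq0; apply: contraNneq => ->; rewrite horner0.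
have U0 : U != 0 by apply: Nz0.
have V0 : V != 0 by apply: Nz0; rewrite hornerZ mulf_neq0.
have g0 : g != 0 by rewrite iota_eq0 polyC_eq0.
have y0 : y != 0 by rewrite iota_eq0 numY_neq0.
have u_root : u ^+ 2 + u + 1 = 0 := iota_w_root w_root.
have u3 : u ^+ 3 = 1 := w_cube u_root.
have i1 : factor P 1 = g2%:P * (r *: A1) ^+ 3.
  by rewrite eA1 eg exprZn mul_polyC scalerA.
have i2 : factor P 2 = g2%:P * A2 ^+ 3 by rewrite eA2 mul_polyC.
have e1 : g * V ^+ 3 = u * x + u ^+ 2 * y.
  rewrite /g /V -rmorphXn -rmorphM -i1 /factor expr1 rmorphM rmorphD rmorphM.
  by rewrite -/u -/x -/y; ring.
have e2 : g * U ^+ 3 = u ^+ 2 * x + u * y.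
  rewrite /g /U -rmorphXn -rmorphM -i2 /factor.
  rewrite rmorphM rmorphXn rmorphD rmorphM rmorphXn.
  rewrite -/u -/x -/y; transitivity (u ^+ 2 * x + u ^+ 3 * u * y); first by ring.
  by rewrite u3 mul1r.
have e0 : x + y = - (g * U ^+ 3) - g * V ^+ 3.
  rewrite e1 e2; apply/eqP; rewrite -subr_eq0; apply/eqP.
  transitivity ((u ^+ 2 + u + 1) * (x + y)); first by ring.
  by rewrite u_root mul0r.
have eprod : (x + y) * (g * V ^+ 3) * (g * U ^+ 3) = noncube_val k * z ^+ 3.
  have := congr1 iota (factor_prod P); rewrite [RHS]rmorphM rmorphXn -k_kp => <-.
  rewrite i1 i2 2!rmorphM; congr (_ * _ * _).
  - by rewrite /factor expr0 !mul1r rmorphD.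
  - by rewrite rmorphM rmorphXn.
  - by rewrite rmorphM rmorphXn.
pose Z := - z / (g * U * V).
have chart : on_chart (noncube_val k) (U / V) (Z / V).
  apply/eqP; transitivity (- (x + y) * (g * V ^+ 3) * (g * U ^+ 3)
                       / (g ^+ 3 * U ^+ 3 * V ^+ 6)).
    by rewrite e0; field; rewrite V0 g0 U0.
  by rewrite !mulNr eprod /Z; field; rewrite V0 g0 U0.
pose Q := @Point K k (_, _) chart; exists Q.
have [n ex ez] := sqrtm3_coord (iota_w_root w_root) Q.
have [Q1 Q2] : Q.1 = U / V /\ Q.2 = Z / V by [].
rewrite -/u Q1 Q2 in n ex ez.
have ek : noncube_val k * (Z / V) ^+ 3 = (U ^+ 3 + V ^+ 3) / V ^+ 3.
  by rewrite -(eqP chart); field.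
pose D := u * U ^+ 3 - u ^+ 2 * V ^+ 3.
have u1 : 1 + u = - u ^+ 2.
  by apply/eqP; rewrite -addr_eq0 -u_root; apply/eqP; ring.
have u2 : 1 + u ^+ 2 = - u.
  by apply/eqP; rewrite -addr_eq0 -u_root; apply/eqP; ring.
have eD : 1 + u * (noncube_val k * (Z / V) ^+ 3) = D / V ^+ 3.
  transitivity ((u * U ^+ 3 + (1 + u) * V ^+ 3) / V ^+ 3).
    by rewrite ek; field.
  by rewrite u1 /D mulNr.
have eN : 1 + u ^+ 2 * (noncube_val k * (Z / V) ^+ 3)
          = (u ^+ 2 * U ^+ 3 - u * V ^+ 3) / V ^+ 3.
  transitivity ((u ^+ 2 * U ^+ 3 + (1 + u ^+ 2) * V ^+ 3) / V ^+ 3).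
    by rewrite ek; field.
  by rewrite u2 mulNr.
have gD : g * D = (u ^+ 2 - u) * y.
  transitivity (u * (g * U ^+ 3) - u ^+ 2 * (g * V ^+ 3)); first by rewrite /D; ring.
  rewrite e1 e2; transitivity ((u ^+ 2 - u ^+ 3 * u) * y); first by ring.
  by rewrite u3 mul1r.
have gN : g * (u ^+ 2 * U ^+ 3 - u * V ^+ 3) = (u - u ^+ 2) * x.
  transitivity (u ^+ 2 * (g * U ^+ 3) - u * (g * V ^+ 3)); first by ring.
  rewrite e1 e2; transitivity ((u ^+ 3 * u - u ^+ 2) * x); first by ring.
  by rewrite u3 mul1r.
have D0 : D != 0 by move: n; rewrite eD mulf_eq0 negb_or => /andP[].
have uu0 : u ^+ 2 - u != 0.
  by have := mulf_neq0 g0 D0; rewrite gD mulf_eq0 negb_or => /andP[].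
apply: point_eq; rewrite ?ex ?ez ?num_x ?num_z -/x -/y -/z.
  transitivity (- (g * (u ^+ 2 * U ^+ 3 - u * V ^+ 3)) / (g * D)).
    by rewrite gN gD; field; rewrite uu0 y0.
  by rewrite eN eD; field; rewrite V0 D0 g0.
transitivity ((u - u ^+ 2) * - z / (g * D)).
  by rewrite gD; field; rewrite uu0 y0.
by rewrite eD /Z; field; rewrite V0 g0 D0 U0.
Qed.

(** Of the three points at infinity only 0 has slot 1, because [inftors] has slot w. *)
Lemma descent_kernel P t0 : t0 \in ts ->
  (forall t, t \in ts -> slot t P = 1) -> exists Q, P = sqrtm3 Q.
Proof.
move=> t0_ts sP; have [Z0|] := eqVneq (numZ P) 0; last first.
  by move=> Z0; apply: (descent_kernel_finite t0_ts).
have kt := kp_root t0_ts; have := sP t0 t0_ts.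
have : P.2 = 0 by rewrite num_z Z0 rmorph0 mul0r.
move/(inftors_multiples (iota_w_root w_root)); rewrite !inE => /or3P[] /eqP ->.
- by exists 0; rewrite raddf0.
- by rewrite slot_inftors // => /eqP; rewrite (negPf w1).
rewrite mulr2n slot_add // slot_inftors // -expr2 => /eqP.
by rewrite -(expr0 w) w_exp_eq.
Qed.

End Descent.

End Heights.
End RationalFunctions.
(** * Dependence by counting points of bounded height *)

Section HeightCounting.
Variables (G : zmodType) (pi : {additive G -> G}) (h : G -> nat) (T Q1 Q2 : G).
Hypothesis pi_sqr : forall P, pi (pi P) = - (P *+ 3).
Hypothesis pi_T : pi T = 0.
Hypothesis h_pi : forall P, h (pi P) = (3 * h P)%N.
Hypothesis h_opp : forall P, h (- P) = h P.
Hypothesis h_add : forall P Q, (h (P + Q)%R <= 2 * h P + 2 * h Q)%N.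
Hypothesis h_eq0 : forall P, h P = 0%N -> P *+ 3 = 0.
Hypothesis decomposition : forall P, exists i j l R,
  [&& (i < 3)%N, (j < 3)%N & P == Q1 *+ i + Q2 *+ j + T *+ l + pi R].

Lemma digits_ex P : exists d : nat * nat * nat * G,
  [&& (d.1.1.1 < 3)%N, (d.1.1.2 < 3)%N &
      P == Q1 *+ d.1.1.1 + Q2 *+ d.1.1.2 + T *+ d.1.2 + pi d.2].
Proof. by have [i [j [l [R H]]]] := decomposition P; exists (i, j, l, R). Qed.

(** The multiple of T is dropped: [pi] kills T, and [digit_eq] compares points only after applying
    [pi]. Nine values remain. *)
Definition digit P := ((xchoose (digits_ex P)).1.1.1
                       + 3 * (xchoose (digits_ex P)).1.1.2)%N.
Definition quotient P := (xchoose (digits_ex P)).2.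

Lemma digit_lt P : (digit P < 9)%N.
Proof.
case/and3P: (xchooseP (digits_ex P)) => + + _.
by rewrite /digit; move: (_.1.1.1) (_.1.1.2) => i j; lia.
Qed.

Lemma digit_eq P Q : digit P = digit Q ->
  pi (P - Q) = pi (pi (quotient P - quotient Q)).
Proof.
rewrite /digit /quotient.
move: (xchooseP (digits_ex P)) (xchooseP (digits_ex Q)).
case: (xchoose _) => -[[i j] l] R; case: (xchoose _) => -[[i' j'] l'] R' /=.
move=> /and3P[i3 j3 /eqP ->] /and3P[i'3 j'3 /eqP ->] e.
have [<- <-] : i = i' /\ j = j' by lia.
rewrite [LHS]raddfB !(raddfD pi, raddfMn pi, raddfN pi) /= pi_T !mul0rn !addr0.
by rewrite opprD addrACA subrr add0r.
Qed.

Fixpoint code n P :=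
  if n is m.+1 then (digit P + 9 * code m (quotient P))%N else 0%N.

Lemma code_lt n P : (code n P < 9 ^ n)%N.
Proof.
elim: n P => [|n IHn] P //=; have := IHn (quotient P); have := digit_lt P.
by rewrite expnS; move: (9 ^ n)%N (code _ _) (digit P) => a b c; lia.
Qed.

Lemma code_eq n P Q : code n P = code n Q ->
  exists z, pi (P - Q) = iter n.+1 pi z.
Proof.
elim: n P Q => [|n IHn] P Q /=; first by exists (P - Q).
move=> e; have [eD eC] : digit P = digit Q
    /\ code n (quotient P) = code n (quotient Q).
  by have := digit_lt P; have := digit_lt Q; lia.
have [z ez] := IHn _ _ eC.
by exists z; rewrite digit_eq // ez.
Qed.

Lemma height_iter n P : h (iter n pi P) = (3 ^ n * h P)%N.
Proof.
by elim: n => [|n IHn]; rewrite ?mul1n //= h_pi IHn expnS mulnA.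
Qed.

Lemma height_zero : h 0 = 0%N.
Proof. by have := h_pi 0; rewrite raddf0; lia. Qed.

(** The height of pi (P - Q) is 3 h(P - Q), and it is 3^(n+1) h(z) for the z given by [code_eq]. If
    h(P - Q) is below 3^n, then h(z) = 0 and P - Q is torsion. *)
Lemma code_eq_height n P Q : code n P = code n Q -> (h (P - Q)%R < 3 ^ n)%N ->
  (P - Q) *+ 9 = 0.
Proof.
move=> /code_eq[z ez] lt; have := h_pi (P - Q); rewrite ez height_iter expnS.
rewrite -mulnA => /eqP; rewrite eqn_pmul2l // => /eqP e.
have hz : h z = 0%N.
  by move: lt; rewrite -e; case: (h z) => // m; rewrite ltnNge leq_pmulr.
have := pi_sqr (P - Q); rewrite ez => e3.
have h3 : h ((P - Q) *+ 3) = 0%N.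
  by rewrite -h_opp -e3 -ez h_pi ez height_iter hz !muln0.
by rewrite -(h_eq0 h3) -mulrnA.
Qed.

Lemma height_mul3 P : h (P *+ 3) = (9 * h P)%N.
Proof. by rewrite -h_opp -pi_sqr !h_pi mulnA. Qed.

Section Box.
Variables (N : nat) (R_ : 'I_N -> G).

Definition combination (a : 'I_N -> nat) := \sum_j R_ j *+ a j.

Definition box_height :=
  \max_(d : {ffun 'I_N -> 'I_3}) h (combination (fun j => d j)).

Lemma height_combination m (a : 'I_N -> nat) : (forall j, a j < 3 ^ m)%N ->
  (h (combination a) <= box_height * 18 ^ m)%N.
Proof.
(* Splitting off the lowest ternary digits gives h <= 2 D + 18 h' with D the box height. Adding D on
   the left absorbs the constant term: 18 h' + 3 D <= 18 (h' + D). *)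
move=> a_lt; suff : (h (combination a) + box_height <= box_height * 18 ^ m)%N.
  by apply: leq_trans; apply: leq_addr.
elim: m a a_lt => [|m IHm] a a_lt.
  have -> : combination a = 0.
    rewrite /combination big1 // => j _.
    by have := a_lt j; rewrite ltnS leqn0 => /eqP ->; rewrite mulr0n.
  by rewrite height_zero muln1.
pose d : {ffun 'I_N -> 'I_3} := [ffun j => inord (a j %% 3)].
pose b j := (a j %/ 3)%N.
have b_lt j : (b j < 3 ^ m)%N by rewrite ltn_divLR // -expnSr.
have -> : combination a = combination (fun j => d j) + combination b *+ 3.
  rewrite /combination -sumrMnl -big_split /=; apply: eq_bigr => j _.
  by rewrite -mulrnA -mulrnDr ffunE inordK ?ltn_mod // addnC -divn_eq.
have hd : (h (combination (fun j => d j)) <= box_height)%N.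
  exact: (leq_bigmax d).
have := h_add (combination (fun j => d j)) (combination b *+ 3).
rewrite height_mul3 expnS; have := IHm b b_lt; move: hd.
rewrite [(box_height * (18 * _))%N]mulnCA.
move: (box_height * 18 ^ m)%N => t.
by move: (h (_ + _)%R) (h (combination b)) (h (combination _)); lia.
Qed.

End Box.

(* The 3^(6m) combinations with coefficients below 3^m have height O(18^m).
   Their differences are detected modulo torsion by n digits as soon as 3^n
   exceeds that bound, whereas there are only 9^n < 3^(6m) codes. *)
Lemma relation_of_six (R_ : 'I_6 -> G) :
  exists2 c : 'I_6 -> int, (exists j, c j != 0) & \sum_j R_ j *~ c j = 0.
Proof.
(* A difference of two combinations has height at most 4 D 18^m, which must stay below 3^n = 27^m /
   3. The choice of m gives (3/2)^m > 12 D through (m + 2) 2^m <= 2 3^m. With n = 3 m - 1 there are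
   9^n = 3^(6m - 2) codes for 3^(6m) combinations. *)
pose D := box_height R_; pose m := (24 * D).+1; pose n := (3 * m).-1.
have big : (12 * D * 18 ^ m < 27 ^ m)%N.
  have H k : ((k + 2) * 2 ^ k <= 2 * 3 ^ k)%N.
    elim: k => [|k IHk] //; rewrite !expnS; move: IHk.
    by move: (2 ^ k)%N (3 ^ k)%N => x y; nia.
  have -> : (18 ^ m = 9 ^ m * 2 ^ m)%N by rewrite -expnMn.
  have -> : (27 ^ m = 9 ^ m * 3 ^ m)%N by rewrite -expnMn.
  rewrite mulnCA ltn_pmul2l ?expn_gt0 //; have := H m.
  have : (0 < 2 ^ m)%N by rewrite expn_gt0.
  by rewrite {2}/m; move: (2 ^ m)%N (3 ^ m)%N => x y; nia.
have n3 : (3 * 3 ^ n = 27 ^ m)%N by rewrite -expnS prednK // expnM.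
pose f (a : {ffun 'I_6 -> 'I_(3 ^ m)}) : 'I_(9 ^ n) :=
  Ordinal (code_lt n (combination R_ (fun j => a j))).
have /injectivePn[a [b nab /(congr1 val) /= eab]] : ~~ injectiveb f.
  apply/negP => /injectiveP /leq_card.
  rewrite card_ffun !card_ord -expnM leqNgt; case/negP.
  have -> : (3 ^ (m * 6) = 9 ^ (3 * m))%N.
    by rewrite -[9%N]/(3 ^ 2)%N -!expnM; congr (_ ^ _)%N; lia.
  by rewrite ltn_exp2l // /n; lia.
have ha := height_combination R_ (fun j => ltn_ord (a j)).
have hb := height_combination R_ (fun j => ltn_ord (b j)).
have lt : (h (combination R_ (fun j => a j) - combination R_ (fun j => b j))%R
           < 3 ^ n)%N.
  have := h_add (combination R_ (fun j => a j)) (- combination R_ (fun j => b j)).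
  rewrite h_opp; move: ha hb big; rewrite -n3 -/D.
  move: (h _) (h _) (h _) (18 ^ m)%N (3 ^ n)%N => x y z t u; nia.
have e9 := code_eq_height eab lt.
exists (fun j => ((a j : nat)%:Z - (b j : nat)%:Z) * 9%:Z).
  have [j nj] : exists j, a j != b j.
    apply/existsP; rewrite -negb_forall; apply: contraNN nab => /forallP eab'.
    by apply/eqP/ffunP => j; apply/eqP.
  exists j; rewrite mulf_eq0 orbF subr_eq0; apply: contraNN nj => /eqP [e].
  exact/eqP/val_inj.
rewrite -[RHS]e9 /combination -sumrB -sumrMnl; apply: eq_bigr => j _.
by rewrite mulrzA mulrzBr.
Qed.

End HeightCounting.
(** * The field Q(omega) and the Selmer group *)

Record eisenstein := Eisenstein { eis_re : rat; eis_im : rat }.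

Section EisensteinField.
Local Notation E := eisenstein.
Implicit Types x y z : E.

Definition eis_pair x := (eis_re x, eis_im x).
Definition pair_eis (p : rat * rat) := Eisenstein p.1 p.2.
Lemma eis_pairK : cancel eis_pair pair_eis. Proof. by case. Qed.

HB.instance Definition _ := Choice.copy E (can_type eis_pairK).

Definition eis_add x y := Eisenstein (eis_re x + eis_re y) (eis_im x + eis_im y).
Definition eis_opp x := Eisenstein (- eis_re x) (- eis_im x).
Definition eis_zero := Eisenstein 0 0.

Lemma eis_addA : associative eis_add.
Proof. by move=> x y z; rewrite /eis_add /= !addrA. Qed.
Lemma eis_addC : commutative eis_add.
Proof. by move=> x y; rewrite /eis_add addrC [eis_im x + _]addrC. Qed.
Lemma eis_add0 : left_id eis_zero eis_add.
Proof. by case=> a b; rewrite /eis_add /= !add0r. Qed.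
Lemma eis_addN : left_inverse eis_zero eis_opp eis_add.
Proof. by case=> a b; rewrite /eis_add /= !addNr. Qed.

HB.instance Definition _ :=
  GRing.isZmodule.Build E eis_addA eis_addC eis_add0 eis_addN.

Definition eis_mul x y :=
  Eisenstein (eis_re x * eis_re y - eis_im x * eis_im y)
             (eis_re x * eis_im y + eis_im x * eis_re y - eis_im x * eis_im y).
Definition eis_one := Eisenstein 1 0.

Lemma eis_mulA : associative eis_mul.
Proof. by move=> x y z; rewrite /eis_mul /=; congr Eisenstein; ring. Qed.
Lemma eis_mulC : commutative eis_mul.
Proof. by move=> x y; rewrite /eis_mul /=; congr Eisenstein; ring. Qed.
Lemma eis_mul1 : left_id eis_one eis_mul.
Proof. by case=> a b; rewrite /eis_mul /=; congr Eisenstein; ring. Qed.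
Lemma eis_mulDl : left_distributive eis_mul eis_add.
Proof. by move=> x y z; rewrite /eis_mul /eis_add /=; congr Eisenstein; ring. Qed.
Lemma eis_one_neq0 : eis_one != 0 :> E.
Proof. by apply/eqP => -[]. Qed.

HB.instance Definition _ := GRing.Zmodule_isComNzRing.Build E
  eis_mulA eis_mulC eis_mul1 eis_mulDl eis_one_neq0.

Definition eis_norm x : rat := eis_re x ^+ 2 - eis_re x * eis_im x + eis_im x ^+ 2.

Lemma eis_normM x y : eis_norm (x * y) = eis_norm x * eis_norm y.
Proof. by case: x y => a b [c d]; rewrite /eis_norm /=; ring. Qed.

Lemma eis_norm_eq0 x : (eis_norm x == 0) = (x == 0).
Proof.
apply/eqP/eqP => [|->]; last by rewrite /eis_norm /=; ring.
case: x => a b; rewrite /eis_norm /= => e.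
have b0 : b ^+ 2 = 0.
  by apply/eqP; rewrite eq_le sqr_ge0 andbT; have := sqr_ge0 (2%:R * a - b); lra.
have a0 : a ^+ 2 = 0.
  by apply/eqP; rewrite eq_le sqr_ge0 andbT; have := sqr_ge0 (2%:R * b - a); lra.
by move/eqP: b0 => /[!sqrf_eq0] /eqP ->; move/eqP: a0 => /[!sqrf_eq0] /eqP ->.
Qed.

Definition eis_inv x :=
  Eisenstein ((eis_re x - eis_im x) / eis_norm x) (- eis_im x / eis_norm x).

Lemma eis_mulV x : x != 0 -> eis_inv x * x = 1.
Proof.
rewrite -eis_norm_eq0; case: x => a b n0.
by congr Eisenstein; move: n0; rewrite /= /eis_norm /= => n0; field.
Qed.

Lemma eis_inv0 : eis_inv 0 = 0.
Proof. by rewrite /eis_inv /= oppr0 subr0 !mul0r. Qed.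

HB.instance Definition _ := GRing.ComNzRing_isField.Build E eis_mulV eis_inv0.

Definition eis_of_rat (a : rat) := Eisenstein a 0.

Lemma eis_of_rat_zmod : zmod_morphism eis_of_rat.
Proof. by move=> a b; congr Eisenstein; rewrite subr0. Qed.
Lemma eis_of_rat_monoid : monoid_morphism eis_of_rat.
Proof. by split=> // a b; congr Eisenstein => /=; ring. Qed.

HB.instance Definition _ :=
  GRing.isZmodMorphism.Build _ _ eis_of_rat eis_of_rat_zmod.
HB.instance Definition _ :=
  GRing.isMonoidMorphism.Build _ _ eis_of_rat eis_of_rat_monoid.

Definition omega_eis := Eisenstein 0 1.

Lemma omega_eis_root : omega_eis ^+ 2 + omega_eis + 1 = 0.
Proof. by congr Eisenstein; rewrite /=; ring. Qed.

Lemma omega_eis_neq1 : omega_eis != 1.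
Proof. by apply/eqP => -[]. Qed.

(* Congruent modulo 3 to the 7-adic valuation, as 2 = -1 modulo 3. *)
Definition val7 (q : rat) := (logn 7 `|numq q| + 2 * logn 7 `|denq q|)%N.

Lemma val7M p q : p != 0 -> q != 0 ->
  val7 (p * q) = (val7 p + val7 q)%N %[mod 3].
Proof.
move=> p0 q0; have pq0 : p * q != 0 by rewrite mulf_neq0.
have npos r : r != 0 -> (0 < `|numq r|)%N by rewrite absz_gt0 numq_eq0.
have dpos r : (0 < `|denq r|)%N by rewrite absz_gt0 denq_neq0.
have e : (`|numq (p * q)| * (`|denq p| * `|denq q|)
          = `|numq p| * `|numq q| * `|denq (p * q)|)%N.
  rewrite -!abszM; congr `|_|%N; apply: (@intr_inj rat).
  rewrite !intrM; have d0 r : (denq r)%:~R != 0 :> rat.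
    by rewrite intr_eq0 denq_neq0.
  have /eqP : (numq (p * q))%:~R / (denq (p * q))%:~R
      = (numq p)%:~R / (denq p)%:~R * ((numq q)%:~R / (denq q)%:~R) :> rat.
    by rewrite !divq_num_den.
  by rewrite mulf_div eqr_div ?mulf_neq0 // => /eqP.
have := congr1 (logn 7) e; rewrite !lognM ?muln_gt0 ?npos ?dpos //.
by rewrite /val7; lia.
Qed.

Definition chi7 x := val7 (eis_norm x).

Lemma chi7M x y : x != 0 -> y != 0 ->
  chi7 (x * y) = (chi7 x + chi7 y)%N %[mod 3].
Proof. by rewrite -!eis_norm_eq0 /chi7 eis_normM; apply: val7M. Qed.

End EisensteinField.

(** Conjugate pairs of roots of T^2 + T + 1, T^2 - 3T + 3 and 3T^2 - 3T + 1, in this order. All slot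
    words are indexed accordingly. *)
Definition kroots : seq eisenstein :=
  [:: Eisenstein 0 1; Eisenstein (-1) (-1); Eisenstein 1 (-1); Eisenstein 2 1;
      Eisenstein (1 / 3) (- 1 / 3); Eisenstein (2 / 3) (1 / 3)].

Definition chi_table : seq (seq nat) :=
  [seq [seq chi7 (t - t') | t' <- kroots] | t <- kroots].

Lemma chi_tableE : chi_table =
  [:: [:: 0; 0; 1; 0; 1; 0];
      [:: 0; 0; 0; 1; 0; 1];
      [:: 1; 0; 0; 0; 0; 1];
      [:: 0; 1; 0; 0; 1; 0];
      [:: 1; 0; 0; 1; 0; 0];
      [:: 0; 1; 1; 0; 0; 0]]%N.
Proof. by vm_compute. Qed.

Lemma uniq_kroots : uniq kroots.
Proof. by vm_compute. Qed.

(** 189 = 63 * 3 is the leading coefficient of k, and its norm is 189^2 = 3^6 * 7^2. This is the 2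
    required in [selmer_test]. *)
Lemma chi_lead : chi7 (Eisenstein 189 0) = 2.
Proof. by vm_compute. Qed.

Fixpoint ternary_words n : seq (seq nat) :=
  if n is m.+1 then [seq a :: v | a <- iota 0 3, v <- ternary_words m]
  else [:: [::]].

Lemma mem_ternary_words n e :
  (e \in ternary_words n) = (size e == n) && all (gtn 3) e.
Proof.
elim: n e => [|n IHn] [|a e] //.
  by apply/negP => /allpairsP[[a' v] [_ _]].
have -> : (size (a :: e) == n.+1) && all (gtn 3) (a :: e)
          = (a < 3)%N && (e \in ternary_words n) by rewrite /= eqSS andbCA -IHn.
have -> : ternary_words n.+1
          = [seq b :: v | b <- iota 0 3, v <- ternary_words n] by [].
apply/allpairsP/andP => [[[a' v] /= [+ Hv [-> ->]]]|[a3 He]].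
  by rewrite (mem_iota 0 3).
by exists (a, e); split; rewrite // (mem_iota 0 3).
Qed.

(** Computable form of [root_weight], with a slot word in place of a point; [root_weight_slots]
    relates the two. *)
Definition weight (e : seq nat) j i :=
  sumn [seq if nth 0 e l == j then nth 0 (nth [::] chi_table i) l else 0
       | l <- iota 0 6]%N.

(* Conditionals, not boolean connectives, so that call-by-value evaluation
   skips the expensive branch. *)
Definition selmer_test (e g : seq nat) :=
  if ((nth 0 g 0 + nth 0 g 1 + nth 0 g 2) %% 3 == 2)%N then
  all (fun i => let u := ((nth 0 e i).+1 %% 3)%N in
                let v := ((nth 0 e i).+2 %% 3)%N in
                (nth 0 g u + weight e u i == nth 0 g v + weight e v i %[mod 3])%N)
      (iota 0 6)
  else false.

Definition slots1 := [:: 0; 0; 1; 2; 2; 1]%N.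
Definition slots2 := [:: 2; 1; 2; 1; 0; 0]%N.

(** The third coefficient multiplies the constant word 1, the slots of the torsion point
    [inftors]. *)
Definition spanned (e : seq nat) :=
  has (fun a => all (fun i => nth 0 e i == nth 0 a 0 * nth 0 slots1 i
                       + nth 0 a 1 * nth 0 slots2 i + nth 0 a 2 %[mod 3])%N
                    (iota 0 6)) (ternary_words 3).

(** Exhaustive check over the 3^6 slot words and the 3^3 classes of the constants g. Substituting
    [chi_tableE] first keeps valuations out of the enumeration. *)
Lemma selmer_spanned :
  all (fun e => all (fun g => if selmer_test e g then spanned e else true)
                    (ternary_words 3)) (ternary_words 6).
Proof. by rewrite /selmer_test /weight chi_tableE; vm_compute. Qed.

Local Notation E := eisenstein.
Local Notation w := omega_eis.

Definition kE : {poly E} := map_poly eis_of_rat kpoly.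

Lemma mul_XsubC2 (a b s p : E) : a + b == s -> a * b == p ->
  ('X - a%:P) * ('X - b%:P) = 'X^2 - s%:P * 'X + p%:P.
Proof. by move=> /eqP <- /eqP <-; rewrite polyCD polyCM; ring. Qed.

Lemma kE_expand :
  kE = 63%:R * (3%:R * 'X ^+ 2 - 3%:R * 'X + 1) * ('X ^+ 2 + 'X + 1)
         * ('X ^+ 2 - 3%:R * 'X + 3%:R).
Proof.
rewrite /kE /kpoly.
rewrite !(rmorph_nat, rmorph1, rmorphXn, rmorphD, rmorphN, rmorphM) /=.
by rewrite map_polyX.
Qed.

Lemma kE_split : kE = Eisenstein 189 0 *: \prod_(t <- kroots) ('X - t%:P).
Proof.
rewrite kE_expand /kroots !big_cons big_nil mulr1.
have h1 : ('X - (Eisenstein 0 1)%:P) * ('X - (Eisenstein (-1) (-1))%:P)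
          = 'X^2 - (-1)%:P * 'X + 1%:P by apply: mul_XsubC2; vm_compute.
have h2 : ('X - (Eisenstein 1 (-1))%:P) * ('X - (Eisenstein 2 1)%:P)
          = 'X^2 - (3%:R)%:P * 'X + (3%:R)%:P by apply: mul_XsubC2; vm_compute.
have h3 : ('X - (Eisenstein (1 / 3) (- 1 / 3))%:P)
            * ('X - (Eisenstein (2 / 3) (1 / 3))%:P)
          = 'X^2 - 1%:P * 'X + (Eisenstein (1 / 3) 0)%:P.
  by apply: mul_XsubC2; vm_compute.
rewrite h3 (mulrA ('X - _)) (mulrA ('X - _)) h1 mulrA h2.
have -> : Eisenstein 189 0 = 63%:R * 3%:R by apply/eqP; vm_compute.
have : 3%:R * (Eisenstein (1 / 3) 0)%:P = 1 :> {poly E}.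
  by rewrite -polyC_natr -polyCM (_ : _ * _ = 1) //; apply/eqP; vm_compute.
rewrite -mul_polyC polyCM !polyC_natr polyCN polyC1.
(* The constant 1/3 becomes a variable c with 3 c = 1, so that [ring] sees only integer
   coefficients. *)
move: (_%:P : {poly E}) => c e.
transitivity (63%:R * (3%:R * 'X ^+ 2 - 3%:R * 'X + 3%:R * c)
   * ('X ^+ 2 + 'X + 1) * ('X ^+ 2 - 3%:R * 'X + 3%:R) : {poly E}).
  by rewrite e.
by ring.
Qed.

Lemma separable_kE : separable_poly kE.
Proof.
by rewrite kE_split (eqp_separable (eqp_scale _ _)) ?separable_prod_XsubC.
Qed.

Lemma size_kE : size kE = 7.
Proof. by rewrite kE_split size_scale // size_prod_XsubC. Qed.

(** * Two explicit points and their slots *)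

Definition quadratic (a b c : rat) : {poly rat} :=
  a%:P + b%:P * 'X + c%:P * 'X^2.

(** Here [pX1 + pY1] is 3(T^2 + T + 1) and [pX2 + pY2] is 3(3T^2 - 3T + 1). Each sum takes one
    rational quadratic factor of k, which explains the pair of zeros in [slots1] and in [slots2]. *)
Definition pX1 := quadratic 6%:R (- 8%:R) 6%:R.
Definition pY1 := quadratic (- 3%:R) 11%:R (- 3%:R).
Definition pX2 := quadratic 6%:R (- 4%:R) 4%:R.
Definition pY2 := quadratic (- 3%:R) (- 5%:R) 5%:R.

Lemma sum_cubes1 : pX1 ^+ 3 + pY1 ^+ 3 = kpoly.
Proof. by rewrite /pX1 /pY1 /quadratic !polyCN !polyC_natr /kpoly; ring. Qed.

Lemma sum_cubes2 : pX2 ^+ 3 + pY2 ^+ 3 = kpoly.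
Proof. by rewrite /pX2 /pY2 /quadratic !polyCN !polyC_natr /kpoly; ring. Qed.

Lemma horner_quadratic a b c (t : E) :
  (map_poly eis_of_rat (quadratic a b c)).[t]
  = eis_of_rat a + eis_of_rat b * t + eis_of_rat c * t ^+ 2.
Proof.
rewrite /quadratic !(rmorphXn, rmorphD, rmorphM) /= map_polyX !map_polyC.
by rewrite !(horner_exp, hornerD, hornerM, hornerC, hornerX).
Qed.

Definition slots_match (X Y : {poly rat}) (s : seq nat) :=
  forall i, (i < 6)%N ->
    (map_poly eis_of_rat Y).[kroots`_i] != 0 /\
    - (map_poly eis_of_rat X).[kroots`_i] / (map_poly eis_of_rat Y).[kroots`_i]
      = w ^+ nth 0%N s i.

Lemma slots_match1 : slots_match pX1 pY1 slots1.
Proof.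
move=> i i6; rewrite !horner_quadratic.
by do 6 ![case: i i6 => [_|i i6]; [by split; [|apply/eqP]; vm_compute|]].
Qed.

Lemma slots_match2 : slots_match pX2 pY2 slots2.
Proof.
move=> i i6; rewrite !horner_quadratic.
by do 6 ![case: i i6 => [_|i i6]; [by split; [|apply/eqP]; vm_compute|]].
Qed.

(** * The rank *)

Section Rank.
Local Notation E := eisenstein.
Local Notation w := omega_eis.
Variables (K0 K : fieldType) (theta : {rmorphism {poly rat} -> K0})
  (iota : {rmorphism {poly E} -> K}) (phi : {rmorphism K0 -> K}).
Hypothesis theta_inj : injective theta.
Hypothesis theta_frac : forall x : K0,
  exists2 ab : {poly rat} * {poly rat}, ab.2 != 0 & x = theta ab.1 / theta ab.2.
Hypothesis iota_inj : injective iota.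
Hypothesis iota_frac : forall x : K,
  exists2 ab : {poly E} * {poly E}, ab.2 != 0 & x = iota ab.1 / iota ab.2.
Hypothesis phi_theta : forall p, phi (theta p) = iota (map_poly eis_of_rat p).

Lemma kE_not_cube (x : K) : x ^+ 3 != iota kE.
Proof. by apply: separable_not_cube; rewrite ?separable_kE ?size_kE. Qed.

Lemma kQ_not_cube (x : K0) : x ^+ 3 != theta kpoly.
Proof.
apply: contraNneq (kE_not_cube (phi x)) => e.
by rewrite -rmorphXn e phi_theta.
Qed.

Definition kK := NonCube kE_not_cube.
Definition kK0 := NonCube kQ_not_cube.

Lemma phi_k : phi (noncube_val kK0) = noncube_val kK.
Proof. exact: phi_theta. Qed.

Lemma kK_iota : noncube_val kK = iota kE. Proof. by []. Qed.

(** For m = a / b, completing the square gives (2a - b)^2 = -3 b^2. On leading coefficients a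
    rational square would then be negative. *)
Lemma no_sixth_root (m : K0) : m ^+ 2 - m + 1 != 0.
Proof.
case: (theta_frac m) => -[a b] /= b0 ->.
have b0t : theta b != 0 by rewrite -(rmorph0 theta) (inj_eq theta_inj).
apply/eqP => e.
have {}e : theta ((2%:R * a - b) ^+ 2) = theta (- (3%:R * b ^+ 2)).
  rewrite !(rmorph_nat, rmorphXn, rmorphD, rmorphN, rmorphM).
  apply/eqP; rewrite -subr_eq0; apply/eqP.
  transitivity (4%:R * theta b ^+ 2
    * ((theta a / theta b) ^+ 2 - theta a / theta b + 1)); first by field.
  by rewrite e mulr0.
have {e} := congr1 lead_coef (theta_inj e).
rewrite lead_coefN lead_coef_exp lead_coefM lead_coef_exp.
have -> : lead_coef (3%:R : {poly rat}) = 3%:R.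
  by rewrite -polyC_natr lead_coefC.
move=> e.
have lb : lead_coef b != 0 by rewrite lead_coef_eq0.
have : 0 < lead_coef b ^+ 2 by rewrite exprn_even_gt0.
by have := sqr_ge0 (lead_coef (2%:R * a - b)); rewrite e; lra.
Qed.

Local Notation w_rootK := (iota_w_root iota omega_eis_root).
Local Notation G := (point kK).
Local Notation sqrtm3 := (sqrtm3 w_rootK : G -> G).
Local Notation omega := (omega w_rootK : G -> G).
Local Notation T := (inftors kK w_rootK).
Local Notation slot := (slot iota_inj iota_frac kK_iota separable_kE).
Local Notation height := (height iota_inj iota_frac kK_iota separable_kE).
Local Notation numZ := (numZ iota_inj iota_frac kK_iota separable_kE).
Local Notation descend := (pmap phi_k).

Lemma kE_root t : t \in kroots -> kE.[t] = 0.
Proof. exact: (kp_root kE_split). Qed.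

Definition cube_roots : seq E := [:: 1; w; w ^+ 2].

Definition slot_exp P t := index (slot t P : E) cube_roots.

Lemma slot_exp_ex P t : t \in kroots ->
  slot t P = w ^+ slot_exp P t
  /\ (slot_exp P t < 3)%N.
Proof.
move=> t_ts.
have : slot t P \in cube_roots.
  have [j j3 ->] := slot_index iota_inj iota_frac kK_iota separable_kE
    omega_eis_root kE_split P t_ts.
  by case: j j3 => [|[|[|//]]] _; rewrite ?expr0 ?expr1 !inE eqxx ?orbT.
rewrite /slot_exp => m; have := m; rewrite -index_mem => lt; split=> //.
rewrite -{1}(nth_index 0 m); move: lt.
by case: (index _ _) => [|[|[|//]]] _; rewrite ?expr0 ?expr1.
Qed.

Definition slots P : seq nat :=
  [seq slot_exp P t | t <- kroots].

Lemma kroots_mem i : (i < 6)%N -> kroots`_i \in kroots.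
Proof. by move=> i6; rewrite mem_nth. Qed.

Lemma slot_slots P i : (i < 6)%N ->
  slot kroots`_i P = w ^+ nth 0%N (slots P) i /\ (nth 0%N (slots P) i < 3)%N.
Proof.
move=> i6; rewrite /slots (nth_map 0) //; apply: slot_exp_ex.
exact: kroots_mem.
Qed.

Lemma slots_words P : slots P \in ternary_words 6.
Proof.
rewrite mem_ternary_words size_map eqxx andTb; apply/(all_nthP 0%N) => i.
by rewrite size_map => /(slot_slots P)[].
Qed.

Lemma omega_exp_eq i j : (i < 3)%N -> (j < 3)%N -> (w ^+ i == w ^+ j) = (i == j).
Proof.
by case: i j => [|[|[|//]]] [|[|[|//]]] // _ _; vm_compute.
Qed.

Lemma root_weight_slots P i j : (i < 6)%N -> (j < 3)%N ->
  root_weight iota_inj iota_frac kK_iota separable_kE w kroots chi7 P j kroots`_i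
    = weight (slots P) j i.
Proof.
move=> i6 j3; rewrite /root_weight /weight sumnE big_map.
rewrite big_mkcond -[in LHS](mkseq_nth 0 kroots) /mkseq big_map -/kroots.
apply: eq_big_seq => l; rewrite mem_iota /= => l6.
have [-> s3] := slot_slots P l6; rewrite omega_exp_eq //.
have -> // : nth 0%N (nth [::] chi_table i) l = chi7 (kroots`_i - kroots`_l).
by rewrite /chi_table (nth_map (0 : E)) // (nth_map (0 : E)).
Qed.

Lemma slots_selmer P : numZ P != 0 -> spanned (slots P).
Proof.
move=> Z0; have [g [g_sum g_rel]] := selmer_condition omega_eis_root
  omega_eis_neq1 kE_split uniq_kroots chi7M Z0.
(* The constants enter only through [chi] modulo 3, so reducing them brings the Selmer condition
   into the range of the finite check. *)
pose gl := [:: g 0 %% 3; g 1 %% 3; g 2 %% 3]%N.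
have gl_words : gl \in ternary_words 3 by rewrite mem_ternary_words /= !ltn_mod.
have := allP (allP selmer_spanned _ (slots_words P)) _ gl_words.
suff -> : selmer_test (slots P) gl by [].
have gl_sum : ((nth 0 gl 0 + nth 0 gl 1 + nth 0 gl 2) %% 3 == 2)%N.
  by rewrite chi_lead in g_sum; move: g_sum; rewrite /gl /=; lia.
have glE u : (u < 3)%N -> nth 0%N gl u = (g u %% 3)%N by case: u => [|[|[|]]].
rewrite /selmer_test gl_sum; apply/allP => i; rewrite mem_iota => /andP[_ i6].
have [es s3] := slot_slots P i6.
have u3 m : (m %% 3 < 3)%N by rewrite ltn_mod.
have := g_rel _ _ (kroots_mem i6) s3 es.
rewrite (root_weight_slots P i6 (u3 _)) (root_weight_slots P i6 (u3 _)) => e.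
apply/eqP; rewrite (glE _ (u3 _)) (glE _ (u3 _)) modnDml modnDml; exact: e.
Qed.

Lemma slot_natmul t P n : t \in kroots -> slot t (P *+ n) = slot t P ^+ n.
Proof.
move=> /kE_root kt; elim: n => [|n IHn]; first by rewrite slot0.
by rewrite mulrS slot_add // IHn exprS.
Qed.

Lemma inftors3 : T *+ 3 = 0.
Proof.
by apply/eqP; rewrite -oppr_eq0 -(sqrtm3_sqr w_rootK) !sqrtm3_inftors raddf0.
Qed.

Lemma height_eq0_multiple P : height P = 0%N -> exists2 l, (l < 3)%N & P = T *+ l.
Proof.
have sz : (1 < size kE)%N by rewrite size_kE.
move=> /(height0 sz) /(inftors_multiples w_rootK).
by rewrite !inE => /or3P[] /eqP ->; [exists 0%N | exists 1%N | exists 2%N].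
Qed.

Section Generators.
Variables Q1 Q2 : point kK0.
Hypotheses (rel1 : cpoint_rel (Some (theta pX1, theta pY1)) Q1)
           (rel2 : cpoint_rel (Some (theta pX2, theta pY2)) Q2).

Lemma slot_affine (X Y : {poly rat}) (Q : point kK0) s :
  cpoint_rel (Some (theta X, theta Y)) Q -> slots_match X Y s ->
  forall i, (i < 6)%N -> slot kroots`_i (descend Q) = w ^+ nth 0%N s i.
Proof.
move=> [_ eQ _] sm i i6; have [Y0 <-] := sm i i6.
apply: slot_fraction Y0.
by rewrite /= eQ fmorph_div !phi_theta.
Qed.

Let slot1 i (i6 : (i < 6)%N) := slot_affine rel1 slots_match1 i6.
Let slot2 i (i6 : (i < 6)%N) := slot_affine rel2 slots_match2 i6.

Let slotT i : (i < 6)%N -> slot kroots`_i T = w.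
Proof. by move=> i6; rewrite slot_inftors //; apply/kE_root/kroots_mem. Qed.

Let w_mod n : w ^+ n = w ^+ (n %% 3).
Proof.
rewrite {1}(divn_eq n 3) exprD mulnC exprM w_cube ?omega_eis_root //.
by rewrite expr1n mul1r.
Qed.

Lemma slot_combination i a b l : (i < 6)%N ->
  slot kroots`_i (descend Q1 *+ a + descend Q2 *+ b + T *+ l)
    = w ^+ (a * nth 0%N slots1 i + b * nth 0%N slots2 i + l).
Proof.
move=> i6; have kt := kE_root (kroots_mem i6).
rewrite !slot_add // !slot_natmul ?kroots_mem // slot1 // slot2 // slotT //.
by rewrite -!exprM -!exprD ![(_ * nth _ _ _)%N]mulnC.
Qed.

Lemma generators_decomposition P : exists i j l R,
  [&& (i < 3)%N, (j < 3)%N &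
      P == descend Q1 *+ i + descend Q2 *+ j + T *+ l + sqrtm3 R].
Proof.
(* The Selmer condition concerns points with Z != 0; points at infinity are multiples of T. *)
have [Z0|/slots_selmer] := eqVneq (numZ P) 0.
  have : P.2 = 0.
    rewrite (num_z iota_inj iota_frac kK_iota separable_kE) Z0 rmorph0.
    by rewrite mul0r.
  move=> /(inftors_multiples w_rootK); rewrite !inE => m.
  have s0 : sqrtm3 0 = 0 by rewrite raddf0.
  exists 0%N, 0%N; case/or3P: m => /eqP ->; [exists 0%N | exists 1%N | exists 2%N];
    by exists 0; rewrite s0 !mulr0n addr0 !add0r eqxx.
case/hasP => a; rewrite mem_ternary_words => /andP[/eqP sz a3] /allP eq_a.
case: a sz a3 eq_a => [|i [|j [|l [|b a]]]] // _ a3 eq_a.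
have /and4P[i3 j3 _ _] : [&& (i < 3)%N, (j < 3)%N, (l < 3)%N & true] := a3.
set D := descend Q1 *+ i + descend Q2 *+ j + T *+ l.
have [R eR] : exists R, P - D = sqrtm3 R.
  apply: (descent_kernel (iota_inj := iota_inj) (iota_frac := iota_frac)
    (k_kp := kK_iota) (sep_kp := separable_kE) omega_eis_root omega_eis_neq1
    kE_split uniq_kroots (kroots_mem (isT : 0 < 6)%N)).
  move=> t /(nthP 0)[m m6 <-]; have kt := kE_root (kroots_mem m6).
  rewrite slot_add // slot_opp // slot_combination //.
  have [-> s3] := slot_slots P m6.
  have m_iota : m \in seq.iota 0 6 by rewrite mem_iota.
  have /eqP e := eq_a m m_iota.
  rewrite w_mod e -w_mod mulfV // expf_neq0 //.
by exists i, j, l, R; rewrite i3 j3 /= -/D -eR addrC subrK.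
Qed.

Let w_exp_mod m n : w ^+ m = w ^+ n -> m = n %[mod 3].
Proof.
rewrite (w_mod m) (w_mod n) => /eqP.
by rewrite omega_exp_eq ?ltn_mod // => /eqP.
Qed.

(** The right side is constant in i because T has slot w at every root. The first root gives l = 2b
    modulo 3; the second then gives b = 0 and the third a = 0. *)
Lemma slots_independent a b l : (a < 3)%N -> (b < 3)%N ->
  (forall i, (i < 6)%N ->
     w ^+ (a * nth 0%N slots1 i + b * nth 0%N slots2 i) = w ^+ l) ->
  a = 0%N /\ b = 0%N.
Proof.
move=> a3 b3 H; have e0 := H 0%N isT.
have e i : (i < 6)%N ->
    (a * nth 0 slots1 i + b * nth 0 slots2 i = b * 2 %[mod 3])%N.
  move=> i6; have := H i i6; rewrite -e0 => /w_exp_mod.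
  by rewrite /= muln0 add0n.
by have := e 1%N isT; have := e 2%N isT; rewrite /=; lia.
Qed.

Lemma height_natmul3 P : height (P *+ 3) = (9 * height P)%N.
Proof.
rewrite -height_opp -(sqrtm3_sqr w_rootK).
by rewrite !(height_sqrtm3 _ _ _ _ _ omega_eis_neq1) mulnA.
Qed.

(** Torsion is allowed on the right because dividing a relation by 3 recovers it only up to torsion.
    The slots force m = 3 m' and n = 3 n'; the combination for m', n' then has height 0, hence is a
    multiple of T, and induction on |m| + |n| applies. *)
Lemma generators_independent (m n : int) l :
  descend Q1 *~ m + descend Q2 *~ n = T *+ l -> m = 0 /\ n = 0.
Proof.
have [N] := ubnP (`|m| + `|n|)%N; elim: N m n l => // N IHN m n l leN e.
pose a := `|(m %% 3)%Z|%N; pose b := `|(n %% 3)%Z|%N.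
pose m' := (m %/ 3)%Z; pose n' := (n %/ 3)%Z.
have em : m = m' * 3 + a%:Z by rewrite /a gez0_abs ?modz_ge0 // -divz_eq.
have en : n = n' * 3 + b%:Z by rewrite /b gez0_abs ?modz_ge0 // -divz_eq.
have a3 : (a < 3)%N by rewrite -ltz_nat /a gez0_abs ?modz_ge0 // ltz_pmod.
have b3 : (b < 3)%N by rewrite -ltz_nat /b gez0_abs ?modz_ge0 // ltz_pmod.
set y := descend Q1 *~ m' + descend Q2 *~ n'.
have {}e : y *+ 3 + (descend Q1 *+ a + descend Q2 *+ b + T *+ 0) = T *+ l.
  rewrite -e em en !mulrzDr !mulrzA mulr0n addr0 /y mulrnDl.
  by rewrite addrACA.
have [a0 b0] : a = 0%N /\ b = 0%N.
  apply: (@slots_independent a b l) => // i i6.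
  have kt := kE_root (kroots_mem i6).
  have := congr1 (slot kroots`_i) e.
  rewrite slot_add // (slot_natmul y 3 (kroots_mem i6)) slot_cube // mul1r.
  rewrite (slot_combination a b 0 i6) addn0.
  by rewrite (slot_natmul T l (kroots_mem i6)) slotT.
have y9 : y *+ 3 *+ 3 = 0.
  have {}e : y *+ 3 = T *+ l by rewrite -e a0 b0 !mulr0n !addr0.
  by rewrite e mulrnAC inftors3 mul0rn.
have hy : height y = 0%N.
  have h0 : height 0 = 0%N.
    by have := height_natmul3 0; rewrite mul0rn; move: (height 0) => h; lia.
  have := height_natmul3 (y *+ 3); rewrite y9 height_natmul3 h0 => /esym/eqP.
  by rewrite !muln_eq0 => /eqP.
have [l' _ ey] := height_eq0_multiple hy.
have [[m'0 n'0]|nz] : m' = 0 /\ n' = 0 \/ (`|m'| + `|n'| < `|m| + `|n|)%N.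
- by move: em en; rewrite a0 b0; lia.
- by rewrite em en a0 b0 m'0 n'0.
have [m'0 n'0] : m' = 0 /\ n' = 0 by apply: (IHN _ _ l') => //; lia.
by rewrite em en a0 b0 m'0 n'0.
Qed.

Lemma two_independent :
  cindependent [:: Some (theta pX1, theta pY1); Some (theta pX2, theta pY2)].
Proof.
move=> [|m [|n [|//]]] // _ e.
have rel : cpoint_rel (clincomb [:: m; n]
    [:: Some (theta pX1, theta pY1); Some (theta pX2, theta pY2)])
    (\sum_(i < 2) [:: Q1; Q2]`_i *~ [:: m; n]`_i).
  by apply: (cpoint_rel_clincomb no_sixth_root) => // -[|[|//]].
have := cpoint_rel_eq0 rel; rewrite e eqxx => /eqP.
rewrite !big_ord_recl big_ord0 /= addr0 => e0.
have := congr1 descend e0; rewrite raddfD !raddfMz raddf0.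
by rewrite -(mulr0n T) => /generators_independent[-> ->].
Qed.

(** If b is nonzero, comparing Z-coordinates in a = - omega b expresses w^2 through elements of
    Q(T). Then -w^2 would be a root of m^2 - m + 1 in Q(T), against [no_sixth_root]. *)
Lemma descend_omega_eq0 (a b : point kK0) :
  descend a + omega (descend b) = 0 -> a = 0 /\ b = 0.
Proof.
move=> e; pose u := iota w%:P.
have u_root : u ^+ 2 + u + 1 = 0 := w_rootK.
have [b20|b20] := eqVneq b.2 0.
  have b0 : b = 0 by apply/eqP; rewrite (point_eq0 no_sixth_root) b20.
  split=> //; apply: (@pmap_inj _ _ _ _ _ phi_k); move: e.
  by rewrite b0 pmap0 [omega 0]raddf0 addr0 => ->.
have b10 := point_neq0 b.
have : descend a = - omega (descend b) by apply/eqP; rewrite -addr_eq0 e.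
move/(congr1 (fun P : G => P.2)) => /= ea.
have eu : u ^+ 2 = phi (a.2 * b.1 / b.2).
  rewrite fmorph_div rmorphM ea -/u; field.
  by rewrite !fmorph_eq0 b10 b20.
pose m := - (a.2 * b.1 / b.2).
have : phi (m ^+ 2 - m + 1) = 0.
  rewrite rmorphD rmorphB rmorphXn rmorph1 /m rmorphN -eu.
  have u3 := w_cube u_root.
  transitivity (u ^+ 3 * u + u ^+ 2 + 1); first by ring.
  by rewrite u3 mul1r [u + _]addrC.
by move/eqP; rewrite fmorph_eq0 (negPf (no_sixth_root m)).
Qed.

Lemma three_dependent (Ps : seq (cpoint K0)) : size Ps = 3 ->
  all (on_cubic (theta kpoly)) Ps -> ~ cindependent Ps.
Proof.
move=> szP /allP onP indep.
have relP i : exists p : point kK0, (i < 3)%N -> cpoint_rel (nth None Ps i) p.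
  have [i3|_] := boolP (i < 3)%N; last by exists 0.
  have [|p rel_p] := @cpoint_rel_ex _ kK0 (nth None Ps i).
    by apply: onP; rewrite mem_nth ?szP.
  by exists p.
have [[p0 /(_ isT) r0] [p1 /(_ isT) r1] [p2 /(_ isT) r2]]
  := And3 (relP 0%N) (relP 1%N) (relP 2%N).
pose ps := [:: p0; p1; p2].
have vanish n0 n1 n2 : p0 *~ n0 + p1 *~ n1 + p2 *~ n2 = 0 ->
    [/\ n0 = 0, n1 = 0 & n2 = 0].
  move=> e; have szn : size [:: n0; n1; n2] = size Ps by rewrite szP.
  have szps : size ps = size Ps by rewrite szP.
  have rel i : (i < size Ps)%N -> cpoint_rel (nth None Ps i) ps`_i.
    by rewrite szP; case: i => [|[|[|]]].
  have := cpoint_rel_eq0 (cpoint_rel_clincomb no_sixth_root szps rel szn).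
  rewrite szP !big_ord_recl big_ord0 /= addr0 addrA e eqxx => /esym/eqP e0.
  by have /and4P[/eqP ? /eqP ? /eqP ? _] := indep _ szn e0.
pose R (j : 'I_6) := nth 0 [:: descend p0; descend p1; descend p2;
  omega (descend p0); omega (descend p1); omega (descend p2)] j.
have [c [j nj]] : exists2 c : 'I_6 -> int,
    (exists j, c j != 0) & \sum_j R j *~ c j = 0.
  apply: (@relation_of_six _ (sqrtm3 : {additive G -> G}) height T
    (descend Q1) (descend Q2)).
  - exact: sqrtm3_sqr.
  - exact: sqrtm3_inftors.
  - by move=> P; apply: height_sqrtm3 omega_eis_neq1 _.
  - exact: height_opp.
  - exact: height_add.
  - by move=> P /height_eq0_multiple[l _ ->]; rewrite mulrnAC inftors3 mul0rn.
  - exact: generators_decomposition.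
(* Indexing the coefficients by natural numbers lets the unfolded sum over six ordinals be matched
   with numerals. *)
pose c' i := c (inord i).
rewrite (eq_bigr (fun j => R j *~ c' j)) => [|i _]; last by rewrite /c' inord_val.
rewrite !big_ord_recl big_ord0 /R /= addr0 => e.
have [] := @descend_omega_eq0 (p0 *~ c' 0%N + p1 *~ c' 1%N + p2 *~ c' 2%N)
                              (p0 *~ c' 3%N + p1 *~ c' 4%N + p2 *~ c' 5%N).
  rewrite !raddfD !raddfMz /= -e -!addrA; do !congr (_ + _).
move=> /vanish[e0 e1 e2] /vanish[e3 e4 e5].
case/eqP: nj; rewrite -[j]inord_val -/(c' j).
by case: (nat_of_ord j) (ltn_ord j) => [|[|[|[|[|[|//]]]]]].
Qed.

End Generators.

Theorem rank_two : MW_rank_eq (theta kpoly) 2.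
Proof.
have on1 : on_cubic (theta kpoly) (Some (theta pX1, theta pY1)).
  by rewrite /= -!rmorphXn -rmorphD sum_cubes1.
have on2 : on_cubic (theta kpoly) (Some (theta pX2, theta pY2)).
  by rewrite /= -!rmorphXn -rmorphD sum_cubes2.
have [Q1 rel1] := @cpoint_rel_ex _ kK0 _ on1.
have [Q2 rel2] := @cpoint_rel_ex _ kK0 _ on2.
split; last by move=> Ps; apply: three_dependent rel1 rel2 Ps.
exists [:: Some (theta pX1, theta pY1); Some (theta pX2, theta pY2)].
split=> //; first by apply/and3P.
exact: two_independent rel1 rel2.
Qed.

End Rank.
Lemma tofrac_inj (R : idomainType) : injective (@tofrac R).
Proof. by move=> a b /eqP; rewrite tofrac_eq => /eqP. Qed.

Theorem theorem1p1 : MW_rank_eq kT 2.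
Proof.
pose f : {rmorphism {poly rat} -> {fraction {poly eisenstein}}} :=
  (@tofrac {poly eisenstein} \o map_poly eis_of_rat).
have f_inj : injective f.
  by move=> p q /tofrac_inj; apply: map_poly_inj.
have [phi phiE] := fraction_lift f_inj.
exact: (rank_two (theta := @tofrac {poly rat}) (iota := @tofrac {poly eisenstein}) (@tofrac_inj _)
  (@fraction_ex _) (@tofrac_inj _) (@fraction_ex _) phiE).
Qed.
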